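(* Let $u_0$ be the strong solution of the local problem $$-u_0''(x)=f(x)\ \text{ for }x\in\Omega,\qquad u_0(-1)=u_0(1)=0,$$ and for each sufficiently small $\delta\in(0,1)$ let $u^{\rm qnl}_\delta$ be a strong solution of the QNL problem $$-\mathcal{L}^{\rm qnl}_\delta u^{\rm qnl}_\delta(x)=f(x)\ \text{ for }x\in\Omega,\qquad u^{\rm qnl}_\delta(x)=0\ \text{ for }x\in\Omega_\delta,$$ with the same $f$. Assume that $u_0$, extended by zero to $(-1-\delta,-1)$, belongs to $C^3(\overline{\Omega\cup\Omega_\delta})$. Then $$\|u^{\rm qnl}_\delta-u_0\|_{L^\infty(\Omega)}=O(\delta)\qquad\text{as }\delta\to 0,$$ i.e. there are constants $C,\delta_0>0$, independent of $\delta$, such that $\|u^{\rm qnl}_\delta-u_0\|_{L^\infty(\Omega)}\le C\delta$ for all $0<\delta<\delta_0$.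
   Context: $\Omega=(-1,1)$ and $\Omega_\delta=(-1-\delta,-1)\cup\{1\}$. The kernel is $\gamma_\delta(s)=\gamma_\delta(|s|)=\delta^{-3}\gamma(|s|/\delta)$ for $s\in\mathbb{R}$, where $\gamma$ (fixed, independent of $\delta$) satisfies $\gamma\ge 0$, is nonincreasing on $(0,1)$, is supported in $[0,1]$ (i.e. $\gamma(r)=0$ for $r>1$), and $\int_{\mathbb{R}}|s|^2\gamma(|s|)\,ds=1$. The weight is $\omega_\delta(x)=\int_0^1 dt\int_{|s|<x/t}|s|^2\gamma_\delta(|s|)\,ds$ for $x>0$ (so $\omega_\delta=1$ on $[\delta,\infty)$). The quasinonlocal operator is $$\mathcal{L}^{\rm qnl}_\delta u(x)=\begin{cases}2\int_{\mathbb{R}}\gamma_\delta(|y-x|)(u(y)-u(x))\,dy, & x\le 0,\\ 2\int_{y<0}\gamma_\delta(|y-x|)(u(y)-u(x))\,dy+(\omega_\delta u')'(x), & 0<x\le\delta,\\ u''(x), & x>\delta,\end{cases}$$ where for $x\in\Omega$ only values of $u$ on $[-1-\delta,1]$ enter, and the integral for $x\le 0$ is taken in the principal value sense if it is not absolutely convergent. A strong solution is one satisfying its equation pointwise in $\Omega$ together with its boundary condition; for the QNL problem it is a function $u:[-1-\delta,1]\to\mathbb{R}$ that is continuous on $[-1-\delta,0]$ and whose restriction to $(0,1]$ extends to a $C^2$ function on $[0,1]$. *)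

(* Defs.v *)
From HB Require Import structures.
From mathcomp Require Import all_boot all_order all_algebra.
From mathcomp Require Import all_classical all_reals all_analysis.

Set Implicit Arguments.
Unset Strict Implicit.
Unset Printing Implicit Defensive.

Import Order.TTheory GRing.Theory Num.Theory.
Import numFieldNormedType.Exports.

Local Open Scope classical_set_scope.
Local Open Scope ring_scope.

(* [gamma] only matters on ]0, +oo[: it may be singular at 0, in which case
   [gamma 0] is a meaningless value. The last condition is an equality of
   extended reals, hence includes the finiteness of the second moment. *)
Definition admissible_kernel {R : realType} (gamma : R -> R) : Prop :=
  [/\ forall r : R, 0 < r -> 0 <= gamma r,
      forall r s : R, 0 < r -> r <= s -> s < 1 -> gamma s <= gamma r,
      forall r : R, 1 < r -> gamma r = 0
    & (\int[lebesgue_measure]_(s in [set: R])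
         (`|s| ^+ 2 * gamma `|s|)%:E)%E = 1%E].

Definition scaled_kernel {R : realType} (gamma : R -> R) (d s : R) : R :=
  d ^- 3 * gamma (`|s| / d).

Definition omega {R : realType} (gamma : R -> R) (d x : R) : R :=
  \int[lebesgue_measure]_(t in `]0, 1])
    \int[lebesgue_measure]_(s in [set s : R | `|s| < x / t])
      (`|s| ^+ 2 * scaled_kernel gamma d s).

(* Principal value at [x] of the integral of [g] over the line; it coincides
   with the Lebesgue integral whenever the latter converges absolutely. *)
Definition pv_integral {R : realType} (x : R) (g : R -> R) : R :=
  lim ((\int[lebesgue_measure]_(y in [set y : R | (e < `|y - x|)%R]) g y)
         @[e --> 0^'+]).

Definition pv_integrable {R : realType} (x : R) (g : R -> R) : Prop :=
  (forall e : R, 0 < e ->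
     lebesgue_measure.-integrable [set y : R | e < `|y - x|] (EFin \o g)) /\
  cvg ((\int[lebesgue_measure]_(y in [set y : R | (e < `|y - x|)%R]) g y)
         @[e --> 0^'+]).

(* For [-1 < x < 1] and [0 < d < 1], only the values of [u] on [-1 - d, 1]
   matter, since the kernel vanishes at distances larger than [d]. *)
Definition Lqnl {R : realType} (gamma : R -> R) (d : R) (u : R -> R) (x : R)
    : R :=
  if x <= 0 then
    2 * pv_integral x (fun y => scaled_kernel gamma d (y - x) * (u y - u x))
  else if x <= d then
    2 * (\int[lebesgue_measure]_(y in [set y : R | y < 0])
           (scaled_kernel gamma d (y - x) * (u y - u x)))
    + derive1 (fun z => omega gamma d z * derive1 u z) x
  else derive1n 2 u x.

(* [lim], [Rintegral] and [derive1] are total: this predicate says that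
   [Lqnl gamma d u x] is not a default value. *)
Definition Lqnl_defined {R : realType} (gamma : R -> R) (d : R) (u : R -> R)
    (x : R) : Prop :=
  if x <= 0 then
    pv_integrable x (fun y => scaled_kernel gamma d (y - x) * (u y - u x))
  else if x <= d then
    [/\ lebesgue_measure.-integrable [set y : R | y < 0]
          (fun y => (scaled_kernel gamma d (y - x) * (u y - u x))%:E),
        \forall z \near x, derivable u z 1
      & derivable (fun z => omega gamma d z * derive1 u z) x 1]
  else (\forall z \near x, derivable u z 1) /\ derivable (derive1 u) x 1.

(* [g] is C^k on [a, b]: [g] is continuous on [a, b] and its derivatives of
   order at most [k] exist in ]a, b[ and extend continuously to [a, b]. *)
Definition Ck_closed {R : realType} (k : nat) (a b : R) (g : R -> R) : Prop :=
  [/\ {within `[a, b], continuous g},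
      forall i, (i < k)%N -> forall x, a < x < b -> derivable (derive1n i g) x 1
    & forall i, (i <= k)%N -> exists h : R -> R,
        {within `[a, b], continuous h} /\
        forall x, a < x < b -> derive1n i g x = h x].

Definition local_strong_solution {R : realType} (f u : R -> R) : Prop :=
  [/\ forall x, -1 < x < 1 ->
        [/\ derivable u x 1, derivable (derive1 u) x 1 & - derive1n 2 u x = f x],
      u (-1) = 0
    & u 1 = 0].

Definition qnl_strong_solution {R : realType} (gamma : R -> R) (d : R)
    (f u : R -> R) : Prop :=
  [/\ {within `[-1 - d, 0], continuous u},
      exists g : R -> R,
        Ck_closed 2 0 1 g /\ forall x, 0 < x <= 1 -> u x = g x,
      forall x, -1 < x < 1 ->
        Lqnl_defined gamma d u x /\ - Lqnl gamma d u x = f x,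
      forall x, -1 - d < x < -1 -> u x = 0
    & u 1 = 0].

Definition Linfty_Omega {R : realType} (v : R -> R) : \bar R :=
  Lnorm (@lebesgue_measure R) +oo%E (EFin \o patch (cst 0) `]-1, 1[ v).

(* Main.v *)
Require Import Defs.
From HB Require Import structures.
From mathcomp Require Import all_boot all_order all_algebra.
From mathcomp Require Import all_classical all_reals all_analysis.
From mathcomp Require Import measurable_realfun ess_sup_inf ring lra.

Set Implicit Arguments.
Unset Strict Implicit.
Unset Printing Implicit Defensive.

Import Order.TTheory GRing.Theory Num.Theory.
Import numFieldNormedType.Exports.

Local Open Scope classical_set_scope.
Local Open Scope ring_scope.

(** Why the error is of order [d].

    The proof is a comparison principle with an explicit barrier. Two things
    have to be controlled: the consistency error of the operator on [u0], and
    the interface at [0], where [u d] is allowed to jump.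

    Write [k] for the scaled kernel, [far_moment k j x] for the integral of
    [k s * |s| ^ j] over [|s| > x]. Exchanging the two integrals in the
    definition of the weight gives (lemma [omegaE])
    [omega x = \int k s * min (s ^ 2) (x * |s|)], from which everything needed
    about [omega] follows: its derivative on the positive half-line is
    [far_moment k 1 x], it tends to [0] at [0+], and it dominates
    [x * far_moment k 1 x], [x ^ 2 * far_moment k 0 x] and
    [1 - far_moment k 2 x].

    On a parabola [P * (y - x) + a / 2 * (y - x) ^ 2] the nonlocal operator
    gives exactly [a]. In the transition layer [0 < x <= d] the first moments
    of the truncated integral cancel against [omega' * P] (no ghost force), but
    the coefficient of [a] is [omega x + far_moment k 2 x / 2], a number that
    is at least [1 / 2] but in general not [1]. So the consistency error on [u0] is
    [O(d)] outside the layer and only [O(1)] inside it; since the layer has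
    width [d], an [O(1)] error there still costs only [O(d)] in the solution.
    Accordingly the barrier is [d] times a concave parabola plus a multiple of
    a concave function of size [O(d)], a constant minus a Huber function, whose
    second derivative is of order [1] on the layer and that is affine away from it.

    If [u - u0 - barrier] had a positive supremum, then [u] would be touched
    from above by a parabola with a strictly smaller value of the operator. A
    maximum point in the nonlocal region, in the interior of the layer or in
    the local region contradicts the equation at that point
    ([no_touching_nonlocal], [no_touching_right]). The remaining possibility is
    that the supremum is only approached at [0+]; there the equation is used at
    a small [x > 0], and all error terms are bounded by [omega x], which is
    small ([no_touching_interface]). Applying the resulting upper bound to [u]
    and to [- u] gives the theorem. *)

(** * Affine changes of variables for the Lebesgue measure *)

Section affine.
Context {R : realType}.
Notation mu := (@lebesgue_measure R).

Lemma measurable_affine (c b : R) :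
  measurable_fun [set: measurableTypeR R] (fun y : R => c * y + b : measurableTypeR R).
Proof. by apply: measurable_funD => //; exact: measurable_funM. Qed.

(** The measure that an affine map with slope [c] transports back to the
    Lebesgue measure; being a measure, it can be compared with the latter on
    intervals only. *)
Definition affine_image (c b : R) : {measure set (measurableTypeR R) -> \bar R} :=
  mscale (NngNum (normr_ge0 c))
    (measure_function_pushforward__canonical__measure_function_Measure mu
      (measurable_affine c b)).

Lemma lebesgue_measure_affine (c b : R) (A : set R) : c != 0 -> measurable A ->
  mu A = affine_image c b A.
Proof.
move=> c0 mA.
apply: lebesgue_measure_unique => //= _ [[x y] _ <-].
rewrite /= /mscale /= /pushforward /=.
move: c0; rewrite neq_lt => /orP[c0|c0].
  rewrite [X in (_ * lebesgue_measure X)%E](_ : _ = `[(y - b) / c, (x - b) / c[%classic); last first.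
    apply/seteqP; split => z /=; rewrite !in_itv/= ler_ndivrMr// ltr_ndivlMr//
      lerBrDr ltrBlDr mulrC andbC //.
  rewrite !lebesgue_measure_itv/= !lte_fin ltr_nM2r ?invr_lt0// ltrD2r.
  case: ifPn => // _; rewrite ?mule0// -EFinM ltr0_norm// -!EFinB.
  by congr EFin; field; rewrite lt_eqF.
rewrite [X in (_ * lebesgue_measure X)%E](_ : _ = `](x - b) / c, (y - b) / c]%classic); last first.
  apply/seteqP; split => z /=; rewrite !in_itv/= ler_pdivlMr// ltr_pdivrMr//
    lerBrDr ltrBlDr mulrC //.
rewrite !lebesgue_measure_itv/= !lte_fin ltr_pM2r ?invr_gt0// ltrD2r.
case: ifPn => // _; rewrite ?mule0// -EFinM gtr0_norm// -!EFinB.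
by congr EFin; field; rewrite gt_eqF.
Qed.

Lemma ge0_integral_affine (c b : R) (D : set R) (f : R -> \bar R) : c != 0 ->
  measurable D -> measurable_fun D f -> (forall x, D x -> 0 <= f x)%E ->
  (\int[mu]_(y in D) f y =
   `|c|%:E * \int[mu]_(y in [set y | D (c * y + b)%R]) f (c * y + b)%R)%E.
Proof.
move=> c0 mD mf f0.
rewrite (@eq_measure_integral _ _ _ _ (affine_image c b)); last first.
  by move=> A mA _; exact: lebesgue_measure_affine.
rewrite ge0_integral_mscale//; congr (_ * _)%E.
rewrite ge0_integral_pushforward//; first exact: measurable_affine.
by move=> y; rewrite inE; exact: f0.
Qed.

(** Unlike the previous lemma, no sign is required: for [|c| = 1] no factor
    multiplies the difference of the integrals of the positive and negative
    parts, which may be undefined. *)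
Lemma Rintegral_isometry (c b : R) (D : set R) (f : R -> R) : `|c| = 1 ->
  measurable D -> measurable_fun D f ->
  \int[mu]_(y in D) f y =
  \int[mu]_(y in [set y | D (c * y + b)]) f (c * y + b).
Proof.
move=> c1 mD mf; rewrite /Rintegral; congr fine.
have c0 : c != 0 by rewrite -normr_eq0 c1 oner_eq0.
have mE : measurable_fun D (EFin \o f) by exact/measurable_EFinP.
rewrite integralE [RHS]integralE.
rewrite (ge0_integral_affine b c0)//; last exact: measurable_funepos.
rewrite (ge0_integral_affine b c0 _ (measurable_funeneg mE))//.
rewrite c1 !mul1e; pose phi (y : R) := c * y + b.
by rewrite (funepos_comp (EFin \o f) phi) (funeneg_comp (EFin \o f) phi).
Qed.

End affine.

Section real_valued_integrable.
Context {R : realType} {D : set R}.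
Notation mu := (@lebesgue_measure R).
Hypothesis mD : measurable D.

Lemma integrable_scale (c : R) (f : R -> R) : mu.-integrable D (EFin \o f) ->
  mu.-integrable D (EFin \o (fun y => c * f y)).
Proof. exact: integrableZl. Qed.

Lemma integrable_add (f g : R -> R) : mu.-integrable D (EFin \o f) ->
  mu.-integrable D (EFin \o g) ->
  mu.-integrable D (EFin \o (fun y => f y + g y)).
Proof. exact: integrableD. Qed.

Lemma integrable_sub (f g : R -> R) : mu.-integrable D (EFin \o f) ->
  mu.-integrable D (EFin \o g) ->
  mu.-integrable D (EFin \o (fun y => f y - g y)).
Proof. exact: integrableB. Qed.

Lemma integrable_domin (f g : R -> R) : measurable_fun D f ->
  (forall y, D y -> `|f y| <= g y) ->
  mu.-integrable D (EFin \o g) -> mu.-integrable D (EFin \o f).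
Proof.
move=> mf fg; apply: le_integrable => //; first exact/measurable_EFinP.
by move=> y /fg h; rewrite /= lee_fin (le_trans h)// ler_norm.
Qed.

End real_valued_integrable.

(** * Kernels with a finite horizon *)

Lemma antitone_measurable {R : realType} (D : set R) (f : R -> R) :
  is_interval D -> (forall x y, D x -> D y -> x <= y -> f y <= f x) ->
  measurable_fun D f.
Proof.
move=> iD fD.
apply: (measurability (@RGenCInfty.G R)) => [|/= _ [_] [r] -> <-].
  exact: RGenCInfty.measurableE.
apply: is_interval_measurable => s t/= [Ds fs] [Dt ft] u /andP[su ut].
have Du : D u by apply: (iD s t) => //; rewrite su ut.
split=> //; move: fs ft; rewrite !in_itv/= !andbT => fs ft.
exact: le_trans ft (fD _ _ Du Dt ut).
Qed.

(** The properties of [scaled_kernel gamma d] on which the analysis rests. Only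
    nonzero arguments are constrained, because the kernel may be singular at [0]. *)
Definition horizon_kernel {R : realType} (d : R) (k : R -> R) : Prop :=
  [/\ forall s, k (- s) = k s,
      forall s, s != 0 -> 0 <= k s,
      forall r s, 0 < r -> r <= s -> s < d -> k s <= k r,
      forall s, d < s -> k s = 0 &
      measurable_fun setT k /\
      (\int[lebesgue_measure]_(s in [set: R]) (s ^+ 2 * k s)%:E = 1)%E].

Lemma scaled_kernelP {R : realType} (gamma : R -> R) (d : R) :
  admissible_kernel gamma -> 0 < d -> horizon_kernel d (scaled_kernel gamma d).
Proof.
move=> [g0 gD gs gI] d0; rewrite /scaled_kernel; split.
- by move=> s; rewrite normrN.
- move=> s s0; rewrite mulr_ge0 ?invr_ge0 ?exprn_ge0 ?(ltW d0)//.
  by rewrite g0// divr_gt0// normr_gt0.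
- move=> r s r0 rs sd; have s0 := lt_le_trans r0 rs.
  rewrite ler_wpM2l ?invr_ge0 ?exprn_ge0 ?(ltW d0)// !gtr0_norm//.
  apply: gD; first by rewrite divr_gt0.
    by rewrite ler_pM2r// invr_gt0.
  by rewrite ltr_pdivrMr// mul1r.
- move=> s ds; have s0 := lt_trans d0 ds.
  by rewrite gs ?mulr0// gtr0_norm// ltr_pdivlMr// mul1r.
(* [gamma] is antitone on ]0, 1[ and zero beyond 1; two single points remain *)
have mg : measurable_fun [set: R] (fun s => gamma `|s|).
  pose G r := (gamma \_ `]0, 1[) r + gamma 0 * \1_[set 0] r + gamma 1 * \1_[set 1] r.
  rewrite (_ : (fun s => _) = G \o @Num.norm _ R); last first.
    apply/funext => s /=; rewrite /G /patch !indicE.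
    move: (`|s| : R) (normr_ge0 s : 0 <= `|s|) => r r0.
    rewrite mem_setE /= in_itv/= !in_set1 -[point]/(0 : R).
    case: (ltgtP r 0) r0 => [//|r0 _|-> _]; last first.
      by rewrite ltr01 (lt_eqF ltr01)/= add0r mulr1 mulr0 addr0.
    by case: (ltgtP r 1) => [_|/gs ->|->]; rewrite /= !(mulr0, mulr1, addr0, add0r).
  apply: measurableT_comp => //; rewrite /G.
  apply: measurable_funD; first apply: measurable_funD.
  - apply: (measurable_restrictT _ _).1 => //.
    apply: antitone_measurable.
      rewrite /is_interval/= => x y. rewrite !in_itv/= => /andP[x0 _] /andP[_ y1] z /andP[xz zy].
      by rewrite in_itv/= (lt_le_trans x0 xz) (le_lt_trans zy y1).
    move=> x y /=; rewrite !in_itv/= => /andP[x0 x1] /andP[y0 y1] xy.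
    exact: gD.
  - by apply: measurable_funM => //; exact: measurable_indic.
  - by apply: measurable_funM => //; exact: measurable_indic.
have mgd : measurable_fun [set: R] (fun s => gamma (`|s| / d)).
  rewrite (_ : (fun s => _) = (fun s => gamma `|s|) \o (fun s => s * d^-1)).
    by apply: measurableT_comp => //; exact: measurable_funM.
  by apply/funext => s /=; rewrite normrM (gtr0_norm (_ : 0 < d^-1)) ?invr_gt0.
split; first by apply: measurable_funM.
transitivity ((\int[lebesgue_measure]_(s in [set: R])
         (`|s| ^+ 2 * gamma `|s|)%:E)%E) => //.
have di : d^-1 != 0 by rewrite invr_neq0 ?gt_eqF.
have pos (s : R) : 0 <= `|s| ^+ 2 * gamma `|s|.
  have [->|s0] := eqVneq s 0; first by rewrite normr0 expr0n mul0r.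
  by rewrite mulr_ge0 ?exprn_ge0// g0// normr_gt0.
rewrite [RHS](ge0_integral_affine 0 di)//; last 2 first.
  apply/measurable_EFinP; apply: measurable_funM => //.
  by apply: measurable_funX.
  by move=> x _; rewrite lee_fin.
have -> : [set y : R | [set: R] (d^-1 * y + 0)] = setT by apply/seteqP; split.
rewrite -ge0_integralZl//; last 2 first.
  apply/measurable_EFinP; under eq_fun do rewrite addr0.
  have mn : measurable_fun [set: R] (fun s : R => `|d^-1 * s|).
    by apply: measurableT_comp => //; exact: mulrl_measurable.
  apply: measurable_funM; first exact: measurable_funX.
  by under eq_fun do rewrite normrM (gtr0_norm (_ : 0 < d^-1)) ?invr_gt0// mulrC.
  by move=> x _; rewrite lee_fin.
apply: eq_integral => s _; rewrite -EFinM addr0; congr EFin.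
rewrite normrM (gtr0_norm (_ : 0 < d^-1)) ?invr_gt0// mulrC [d^-1 * `|s|]mulrC.
rewrite exprMn real_normK ?num_real//.
set q := gamma _; field.
by rewrite gt_eqF.
Qed.

(** * Moments of the kernel *)

Section moments.
Context {R : realType}.
Notation mu := (@lebesgue_measure R).

Lemma measurable_subr (x : R) (D : set R) : measurable_fun D (fun y : R => y - x).
Proof. by apply: measurable_funB. Qed.

Definition far_moment (k : R -> R) (j : nat) (x : R) : R :=
  \int[mu]_(s in [set s : R | x < `|s|]) (k s * `|s| ^+ j).

(** The closed form of [omega], see [omegaE]. *)
Definition weight (k : R -> R) (x : R) : R :=
  \int[mu]_s (k s * Num.min (s ^+ 2) (x * `|s|)).

Variables (d : R) (k : R -> R).
Hypothesis hk : horizon_kernel d k.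

Let kN s : k (- s) = k s. Proof. by case: hk. Qed.

Let k_ge0 s : s != 0 -> 0 <= k s. Proof. by case: hk => _ + _ _ _; exact. Qed.

Let mk : measurable_fun setT k. Proof. by case: hk => _ _ _ _ []. Qed.

Let k2_ge0 s : 0 <= k s * s ^+ 2.
Proof.
have [->|s0] := eqVneq s 0; first by rewrite expr0n mulr0.
by rewrite mulr_ge0 ?k_ge0// sqr_ge0.
Qed.

Lemma kernel_shift_measurable (x : R) (D : set R) :
  measurable_fun D (fun y => k (y - x)).
Proof.
rewrite (_ : (fun y => _) = k \o (fun y => y - x)) //.
by apply: measurableT_comp => //; exact: measurable_subr.
Qed.

Lemma second_moment_integrable (x : R) :
  mu.-integrable setT (EFin \o (fun y => k (y - x) * (y - x) ^+ 2)).
Proof.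
have m1 (c : R) : measurable_fun setT (fun y : R => k (y - c) * (y - c) ^+ 2).
  apply: measurable_funM; first exact: kernel_shift_measurable.
  by apply: measurable_funX; exact: measurable_subr.
apply/integrableP; split; first by apply/measurable_EFinP; exact: m1.
under eq_integral => y _ do rewrite /= (ger0_norm (k2_ge0 _)).
suff -> : (\int[mu]_y (k (y - x) * (y - x) ^+ 2)%:E = 1)%E by rewrite ltry.
have [_ _ _ _ [_ <-]] := hk.
rewrite [RHS](ge0_integral_affine (- x) (oner_neq0 _))//; last 2 first.
- apply/measurable_EFinP.
  rewrite (_ : (fun s => _) = (fun y => k (y - 0) * (y - 0) ^+ 2)); first exact: m1.
  by apply/funext => s; rewrite subr0 mulrC.
- by move=> s _; rewrite lee_fin mulrC.
rewrite normr1 mul1e; apply: eq_integral => s _.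
by rewrite mul1r mulrC.
Qed.

(** Away from the singularity [k] is dominated by a multiple of [s ^ 2 * k s],
    so every function of at most quadratic growth is integrable against it. *)
Lemma integrable_far (x e C : R) (D : set R) (F : R -> R) : 0 < e ->
  measurable D -> (forall y, D y -> e < `|y - x|) -> measurable_fun D F ->
  (forall y, D y -> `|F y| <= C * (1 + (y - x) ^+ 2)) ->
  mu.-integrable D (EFin \o (fun y => k (y - x) * F y)).
Proof.
move=> e0 mD De mF FC.
have i2 : mu.-integrable D (EFin \o (fun y => (`|C| * (e ^- 2 + 1)) *
    (k (y - x) * (y - x) ^+ 2))).
  apply: (integrableS measurableT) => //; apply: integrable_scale => //.
  exact: second_moment_integrable.
apply: (integrable_domin mD _ _ i2).
  by apply: measurable_funM => //; exact: kernel_shift_measurable.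
move=> y Dy /=.
have := De y Dy; set s := y - x => es.
have s0 : s != 0 by rewrite -normr_eq0 gt_eqF// (lt_trans e0).
rewrite normrM (ger0_norm (k_ge0 s0)) mulrCA ler_wpM2l ?k_ge0//.
apply: (le_trans (FC _ Dy)).
have -> : (`|C| * (e ^- 2 + 1)) * s ^+ 2 = `|C| * (e ^- 2 * s ^+ 2 + s ^+ 2) by ring.
have q1 : 1 <= e ^- 2 * s ^+ 2.
  rewrite mulrC ler_pdivlMr ?exprn_gt0// mul1r -(real_normK (num_real s)).
  by rewrite ler_pXn2r ?nnegrE ?(ltW e0)// ltW.
apply: (@le_trans _ _ (`|C| * (1 + s ^+ 2))).
  by rewrite ler_wpM2r ?ler_norm// addr_ge0// sqr_ge0.
by rewrite ler_wpM2l// lerD2r.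
Qed.

Lemma measurable_far (x e : R) : measurable [set y : R | e < `|y - x|].
Proof.
rewrite (_ : [set _ | _] = `]-oo, (x - e)[ `|` `](x + e), +oo[); last first.
  apply/seteqP; split => y /=; rewrite !in_itv/= andbT lter_normr.
    by move=> /orP[h|h]; [right|left]; lra.
  by move=> [h|h]; apply/orP; [right|left]; lra.
by apply: measurableU; exact: measurable_itv.
Qed.

(** Seen from [x], the half-line [y < 0] is one of the two half-lines at distance
    more than [x], and the kernel is even. *)
Lemma left_moment (j : nat) (x : R) : (j <= 2)%N -> 0 < x ->
  \int[mu]_(y in [set y : R | y < 0]) (k (y - x) * `|y - x| ^+ j) =
  far_moment k j x / 2.
Proof.
move=> j2 x0.
have bnd (s : R) : `| `|s| ^+ j | <= 1 * (1 + (s - 0) ^+ 2).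
  rewrite subr0 mul1r normrX normr_id -(real_normK (num_real s)).
  have := normr_ge0 s; set r := `|s| => r0.
  by case: j j2 => [|[|[|//]]] _; rewrite ?expr0 ?expr1; nra.
have mf D : measurable_fun D (fun s : R => `|s| ^+ j).
  by apply: measurable_funX; exact: measurable_funTS.
have mkf D : measurable_fun D (fun s : R => k s * `|s| ^+ j).
  by apply: measurable_funM => //; exact: measurable_funTS.
have mL : measurable [set s : R | s < - x].
  by rewrite -set_itvNyo; exact: measurable_itv.
have mR : measurable [set s : R | x < s].
  by rewrite -set_itvoy; exact: measurable_itv.
have L : \int[mu]_(y in [set y : R | y < 0]) (k (y - x) * `|y - x| ^+ j) =
    \int[mu]_(s in [set s : R | s < - x]) (k s * `|s| ^+ j).
  rewrite (Rintegral_isometry (- x) (normr1 R) mL (mkf _)) /=.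
  rewrite (_ : [set y : R | y < 0] = [set y | 1 * y - x < - x]).
    by apply: eq_Rintegral => s _; rewrite mul1r.
  by apply/seteqP; split => s /=; lra.
have N1 : `|-1 : R| = 1 by rewrite normrN normr1.
have Rr : \int[mu]_(s in [set s : R | x < s]) (k s * `|s| ^+ j) =
    \int[mu]_(s in [set s : R | s < - x]) (k s * `|s| ^+ j).
  rewrite (Rintegral_isometry 0 N1 mL (mkf _)) /=.
  rewrite (_ : [set s : R | x < s] = [set y | -1 * y + 0 < - x]).
    by apply: eq_Rintegral => s _; rewrite mulN1r addr0 kN normrN.
  by apply/seteqP; split => s /=; lra.
have -> : far_moment k j x = \int[mu]_(s in [set s : R | s < - x]) (k s * `|s| ^+ j) +
    \int[mu]_(s in [set s : R | x < s]) (k s * `|s| ^+ j).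
  rewrite -Rintegral_setU//.
  - congr (Rintegral _ _ _); apply/seteqP; split => s /=; rewrite lter_normr.
      by move=> /orP[h|h]; [right|left]; lra.
    by move=> [h|h]; apply/orP; [right|left]; lra.
  - rewrite (_ : (fun s : R => _) = (fun s => k (s - 0) * `|s| ^+ j)); last first.
      by apply/funext => s; rewrite subr0.
    apply: (integrable_far (C := 1) x0) => //; first exact: measurableU.
    move=> s /=; rewrite subr0 lter_normr.
    by move=> [h|h]; apply/orP; [right|left]; lra.
  - by apply/disj_setPS => s [/= h1 h2]; lra.
by rewrite L Rr; lra.
Qed.

(** Quadratic majorants pass through the truncated principal value: the linear
    part is odd about [x] and integrates to zero. *)
Lemma far_integral_le (x e p a : R) (F : R -> R) : 0 < e ->
  mu.-integrable [set y | e < `|y - x|] (EFin \o (fun y => k (y - x) * F y)) ->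
  (forall y, e < `|y - x| -> `|y - x| <= d ->
     F y <= p * (y - x) + a / 2 * (y - x) ^+ 2) ->
  \int[mu]_(y in [set y | e < `|y - x|]) (k (y - x) * F y) <=
  a / 2 * far_moment k 2 e.
Proof.
move=> e0 iF HF; set E := [set y | _].
have mE : measurable E by exact: measurable_far.
have EE y : E y -> e < `|y - x| by [].
have mB D : measurable_fun D (fun y : R => y - x) by exact: measurable_funB.
have mX D : measurable_fun D (fun y : R => (y - x) ^+ 2) by exact: measurable_funX.
have i1 : mu.-integrable E (EFin \o (fun y => k (y - x) * (y - x))).
  apply: (integrable_far (C := 1) e0) => // y _.
  have := sqr_ge0 (y - x + 1); have := sqr_ge0 (y - x - 1); have := sqr_ge0 (y - x).
  by rewrite mul1r ler_norml => h1 h2 h3; apply/andP; split; nra.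
have i2 : mu.-integrable E (EFin \o (fun y => k (y - x) * (y - x) ^+ 2)).
  apply: (integrable_far (C := 1) e0) => // y _.
  by rewrite mul1r ger0_norm ?sqr_ge0// lerDr.
have odd : \int[mu]_(y in E) (k (y - x) * (y - x)) = 0.
  set I := LHS; suff : I = - I by lra.
  have N1 : `|-1 : R| = 1 by rewrite normrN normr1.
  rewrite {1}/I (Rintegral_isometry (2 * x) N1 mE) /=; last first.
    by apply: measurable_funM => //; exact: kernel_shift_measurable.
  rewrite (_ : [set y | E (-1 * y + 2 * x)] = E); last first.
    apply/seteqP; split => y; rewrite /E/= -[in X in X -> _]normrN.
      by rewrite (_ : - (-1 * y + 2 * x - x) = y - x)//; ring.
    by rewrite (_ : - (y - x) = -1 * y + 2 * x - x)//; ring.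
  rewrite -[RHS]mulN1r /I -RintegralZl//; apply: eq_Rintegral => y _.
  by rewrite (_ : -1 * y + 2 * x - x = - (y - x)) ?kN; ring.
have ev : \int[mu]_(y in E) (k (y - x) * (y - x) ^+ 2) = far_moment k 2 e.
  rewrite /far_moment.
  have mF : measurable [set s : R | e < `|s|].
    by have := measurable_far 0 e; under eq_set do rewrite subr0.
  rewrite (Rintegral_isometry (- x) (normr1 R) mF) /=; last first.
    by apply: measurable_funM; [exact: measurable_funTS|exact: measurable_funX].
  rewrite (_ : [set y | e < `|1 * y - x|] = E).
    by apply: eq_Rintegral => y _; rewrite mul1r real_normK ?num_real.
  by apply/seteqP; split => y; rewrite /E/= mul1r.
have -> : a / 2 * far_moment k 2 e = \int[mu]_(y in E)
    (p * (k (y - x) * (y - x)) + a / 2 * (k (y - x) * (y - x) ^+ 2)).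
  rewrite RintegralD//; try exact: integrable_scale.
  by rewrite !RintegralZl// odd ev mulr0 add0r.
apply: le_Rintegral => //.
  by apply: integrable_add => //; exact: integrable_scale.
move=> y Ey; have ye : 0 < `|y - x| by exact: lt_trans Ey.
have y0 : y - x != 0 by rewrite -normr_gt0.
have [yd|yd] := lerP `|y - x| d.
  have := ler_wpM2l (k_ge0 y0) (HF _ Ey yd).
  by move=> /le_trans; apply; rewrite le_eqVlt; apply/orP; left; apply/eqP; ring.
have -> : k (y - x) = 0.
  case: hk => _ _ _ kd _; have [h|h] := lerP 0 (y - x).
    by rewrite kd// -(ger0_norm h).
  by rewrite -kN kd// -(ltr0_norm h).
by rewrite !mul0r !mulr0 addr0.
Qed.

(** The one-sided counterpart: here the linear part survives, as a first moment
    that the derivative of the weight will cancel. *)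
Lemma left_integral_le (x p a b : R) (F : R -> R) : 0 < x ->
  mu.-integrable [set y | y < 0] (EFin \o (fun y => k (y - x) * F y)) ->
  (forall y, y < 0 -> `|y - x| <= d ->
     F y <= p * (y - x) + a / 2 * (y - x) ^+ 2 + b) ->
  2 * (\int[mu]_(y in [set y | y < 0]) (k (y - x) * F y)) <=
  - p * far_moment k 1 x + a / 2 * far_moment k 2 x + b * far_moment k 0 x.
Proof.
move=> x0 iF HF; set E := [set y | _].
have mE : measurable E by rewrite /E -set_itvNyo; exact: measurable_itv.
have EE y : E y -> x < `|y - x| by rewrite /E/= => y0; rewrite ltr0_norm; lra.
have mB D : measurable_fun D (fun y : R => `|y - x|).
  by apply: measurableT_comp => //; exact: measurable_funB.
have i j : (j <= 2)%N ->
    mu.-integrable E (EFin \o (fun y => k (y - x) * `|y - x| ^+ j)).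
  move=> j2; apply: (integrable_far (C := 1) x0) => //.
    by apply: measurable_funX.
  move=> y _; rewrite mul1r normrX normr_id -(real_normK (num_real (y - x))).
  have := normr_ge0 (y - x); set r := `|y - x| => r0.
  by case: j j2 => [|[|[|//]]] _; rewrite ?expr0 ?expr1; nra.
have -> : - p * far_moment k 1 x + a / 2 * far_moment k 2 x + b * far_moment k 0 x =
    2 * \int[mu]_(y in E)
    (- p * (k (y - x) * `|y - x| ^+ 1) + (a / 2 * (k (y - x) * `|y - x| ^+ 2) +
       b * (k (y - x) * `|y - x| ^+ 0))).
  rewrite RintegralD//; [|exact: (integrable_scale mE _ (i 1%N _))|]; last first.
    by apply: integrable_add => //;
      apply: integrable_scale => //; exact: i.
  rewrite RintegralD//; try (apply: integrable_scale => //; exact: i).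
  rewrite !RintegralZl//; try exact: i.
  by rewrite !left_moment//; field.
rewrite ler_wpM2l//; apply: le_Rintegral => //.
  apply: integrable_add => //.
    by apply: integrable_scale => //; exact: i.
  by apply: integrable_add => //;
      apply: integrable_scale => //; exact: i.
move=> y Ey; have xy : y - x < 0 by move: Ey; rewrite /E/=; lra.
have y0 : y - x != 0 by rewrite lt_eqF.
rewrite (ltr0_norm xy) expr0 expr1 sqrrN.
have [yd|yd] := lerP `|y - x| d.
  have := ler_wpM2l (k_ge0 y0) (HF _ Ey yd).
  by move=> /le_trans; apply; rewrite le_eqVlt; apply/orP; left; apply/eqP; ring.
have -> : k (y - x) = 0.
  by case: hk => _ _ _ kd _; rewrite -kN kd// -(ltr0_norm xy).
by rewrite !mul0r !mulr0 !addr0.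
Qed.

End moments.

(** * The weight *)

Lemma is_derive_quadratic {R : realType} (f : R -> R) (x l C rho : R) : 0 < rho ->
  (forall z, `|z - x| <= rho -> `|f z - f x - l * (z - x)| <= C * (z - x) ^+ 2) ->
  is_derive x 1 f l.
Proof.
move=> rho0 H.
have C0 : 0 <= C.
  have := H (x + rho); rewrite addrC addKr (gtr0_norm rho0) lexx => /(_ isT) h.
  by have := le_trans (normr_ge0 _) h; rewrite pmulr_lge0// exprn_gt0.
have cv : (fun h => h^-1 *: (f (h *: 1 + x) - f x)) @ 0^' --> l.
  apply/cvgrPdist_le => /= e e0; near=> h.
  have h0 : h != 0 by near: h; exact: nbhs_dnbhs_neq.
  have hr : `|h| <= rho by near: h; apply: dnbhs0_le.
  have hC : `|h| <= e / (C + 1).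
    by near: h; apply: dnbhs0_le; rewrite divr_gt0// ltr_wpDl.
  have := H (h + x); rewrite addrK => /(_ hr) Hh.
  rewrite [h *: 1]mulr1 -[_ *: _]/(_ * _).
  have -> : l - h^-1 * (f (h + x) - f x) = - h^-1 * (f (h + x) - f x - l * h).
    by field.
  rewrite normrM normrN normfV ler_pdivrMl ?normr_gt0//.
  apply: (le_trans Hh); rewrite -(real_normK (num_real h)) expr2 mulrCA.
  rewrite ler_wpM2l//; move: hC; rewrite ler_pdivlMr ?ltr_wpDl//.
  by have := normr_ge0 h; nra.
have dv : derivable f x 1 by apply/cvg_ex; exists l.
apply: DeriveDef => //; exact: cvg_lim.
Unshelve. all: by end_near. Qed.

Section weight.
Context {R : realType}.
Notation mu := (@lebesgue_measure R).
Variables (d : R) (k : R -> R).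
Hypothesis hk : horizon_kernel d k.

Let k_ge0 s : s != 0 -> 0 <= k s. Proof. by case: hk => _ + _ _ _; exact. Qed.

Let mk : measurable_fun setT k. Proof. by case: hk => _ _ _ _ []. Qed.

Let kM_ge0 s t : (s = 0 -> t = 0) -> 0 <= t -> 0 <= k s * t.
Proof.
move=> st t0; have [s0|s0] := eqVneq s 0; first by rewrite (st s0) mulr0.
by rewrite mulr_ge0 ?k_ge0.
Qed.

Let k_ler s t t' : (s = 0 -> t' = t) -> t <= t' -> k s * t <= k s * t'.
Proof.
move=> st tt; have [s0|s0] := eqVneq s 0; first by rewrite (st s0).
by rewrite ler_wpM2l// k_ge0.
Qed.

Let i2 : mu.-integrable setT (EFin \o (fun s => k s * s ^+ 2)).
Proof.
have := second_moment_integrable hk 0.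
by congr (integrable _ _ _); apply/funext => s /=; rewrite subr0.
Qed.

Let int2 : \int[mu]_s (k s * s ^+ 2) = 1.
Proof.
case: hk => _ _ _ _ [_ h]; rewrite /Rintegral.
by under eq_integral do rewrite mulrC; rewrite h.
Qed.

Let m (x s : R) : R := Num.min (s ^+ 2) (x * `|s|).

Let m0 x : m x 0 = 0. Proof. by rewrite /m expr0n normr0 mulr0 minxx. Qed.

Let m_ge0 (x s : R) : 0 <= x -> 0 <= m x s.
Proof. by move=> x0; rewrite /m le_min sqr_ge0 mulr_ge0. Qed.

Lemma weight_integrable (x : R) : 0 <= x ->
  mu.-integrable setT (EFin \o (fun s => k s * Num.min (s ^+ 2) (x * `|s|))).
Proof.
move=> x0; apply: (integrable_domin measurableT _ _ i2).
  apply: measurable_funM; first exact: mk.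
  apply: measurable_minr => //; apply: measurable_funM => //.
move=> s _; rewrite -/(m x s) ger0_norm.
  apply: k_ler; first by move=> ->; rewrite m0 expr0n.
  by rewrite /m ge_min lexx.
by apply: kM_ge0; [move=> ->; exact: m0|exact: m_ge0].
Qed.

Lemma weight_ge0 (x : R) : 0 <= x -> 0 <= weight k x.
Proof.
move=> x0; apply: Rintegral_ge0 => s _; rewrite -/(m x s).
by apply: kM_ge0; [move=> ->; exact: m0|exact: m_ge0].
Qed.

Lemma weight_nondecreasing (x y : R) : 0 <= x -> x <= y -> weight k x <= weight k y.
Proof.
move=> x0 xy; apply: le_Rintegral => //; try apply: weight_integrable => //.
  exact: le_trans xy.
move=> s _; apply: k_ler; first by move=> ->; rewrite -/(m x 0) -/(m y 0) !m0.
by rewrite le_min !ge_min lexx /= ler_wpM2r// orbT.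
Qed.

Let far (x : R) := [set s : R | x < `|s|].

Let mfar (x : R) : measurable (far x).
Proof.
have := measurable_far 0 x; congr (measurable _).
by apply/funext => s /=; rewrite subr0.
Qed.

Lemma far_moment_integrable (j : nat) (x : R) : (j <= 2)%N -> 0 < x ->
  mu.-integrable setT (EFin \o ((fun s => k s * `|s| ^+ j) \_ (far x))).
Proof.
move=> j2 x0; rewrite -restrict_EFin.
apply: (@integrable_mkcond _ _ R mu (far x) _ _).1; first exact: mfar.
rewrite (_ : (fun s : R => _) = (fun s => k (s - 0) * `|s| ^+ j)); last first.
  by apply/funext => s; rewrite subr0.
apply: (integrable_far hk (C := 1) x0) => //.
- by move=> y; rewrite subr0.
- by apply: measurable_funX; exact: measurable_funTS.
move=> s _; rewrite subr0 mul1r normrX normr_id -(real_normK (num_real s)).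
have := normr_ge0 s; set r := `|s| => r0.
by case: j j2 => [|[|[|//]]] _; rewrite ?expr0 ?expr1; nra.
Qed.

Let farE j (x : R) : far_moment k j x = \int[mu]_s ((fun s => k s * `|s| ^+ j) \_ (far x)) s.
Proof. exact: Rintegral_mkcond. Qed.

Let far_patchE (f : R -> R) (x s : R) : (f \_ (far x)) s = if x < `|s| then f s else 0.
Proof. by rewrite /patch mem_setE. Qed.

Lemma far_moment_ge0 (j : nat) (x : R) : 0 < x -> 0 <= far_moment k j x.
Proof.
move=> x0; apply: Rintegral_ge0 => s /= xs.
by rewrite mulr_ge0 ?exprn_ge0// k_ge0// -normr_gt0 (lt_trans x0).
Qed.

Lemma far_moment2_le1 (x : R) : 0 < x -> far_moment k 2 x <= 1.
Proof.
move=> x0; rewrite farE -int2; apply: le_Rintegral => //.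
  exact: far_moment_integrable.
move=> s _; rewrite far_patchE real_normK ?num_real//; case: ifP => // _.
by apply: kM_ge0; [move=> ->; rewrite expr0n|exact: sqr_ge0].
Qed.

(** At distance at most [x] the weight integrand is the full [k s * s ^ 2]. *)
Lemma far_moment2_ge (x : R) : 0 < x -> 1 - weight k x <= far_moment k 2 x.
Proof.
move=> x0; rewrite lerBlDl farE -int2 -RintegralD//; last 2 first.
- by apply: weight_integrable; exact: ltW.
- exact: far_moment_integrable.
apply: le_Rintegral => //.
  apply: integrable_add => //; last exact: far_moment_integrable.
  by apply: weight_integrable; exact: ltW.
move=> s _; rewrite far_patchE real_normK ?num_real//; case: ifPn => [_|].
  rewrite lerDr -/(m x s); apply: kM_ge0; first by move=> ->; exact: m0.
  by apply: m_ge0; exact: ltW.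
rewrite -leNgt addr0 => sx; rewrite min_l// -(real_normK (num_real s)).
by rewrite expr2 ler_wpM2r.
Qed.

Lemma far_moment1_le (x : R) : 0 < x -> x * far_moment k 1 x <= weight k x.
Proof.
move=> x0; rewrite farE -RintegralZl//; last exact: far_moment_integrable.
apply: le_Rintegral => //.
- by apply: integrable_scale => //; exact: far_moment_integrable.
- by apply: weight_integrable; exact: ltW.
move=> s _; rewrite far_patchE; case: ifPn => [xs|_]; last first.
  rewrite mulr0 -/(m x s); apply: kM_ge0; first by move=> ->; exact: m0.
  by apply: m_ge0; exact: ltW.
rewrite min_r; first by rewrite expr1 mulrCA.
by rewrite -(real_normK (num_real s)) expr2 ler_wpM2r// ltW.
Qed.

Lemma far_moment0_le (x : R) : 0 < x -> x ^+ 2 * far_moment k 0 x <= weight k x.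
Proof.
move=> x0; rewrite farE -RintegralZl//; last exact: far_moment_integrable.
apply: le_Rintegral => //.
- by apply: integrable_scale => //; exact: far_moment_integrable.
- by apply: weight_integrable; exact: ltW.
move=> s _; rewrite far_patchE; case: ifPn => [xs|_]; last first.
  rewrite mulr0 -/(m x s); apply: kM_ge0; first by move=> ->; exact: m0.
  by apply: m_ge0; exact: ltW.
rewrite min_r; last first.
  by rewrite -(real_normK (num_real s)) expr2 ler_wpM2r// ltW.
rewrite expr0 mulr1 mulrC ler_wpM2l//.
  by rewrite k_ge0// -normr_gt0 (lt_trans x0).
by rewrite expr2 ler_wpM2l// ltW.
Qed.

(* the value at distance exactly [d] is not controlled by monotonicity *)
Let bounded_away (r : R) : 0 < d -> 0 < r ->
  exists2 M : R, 0 <= M & forall s, r <= `|s| -> k s <= M.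
Proof.
case: hk => kN _ kD ks _ d0 r0.
pose q := Num.min r (d / 2).
have q0 : 0 < q by rewrite lt_min r0 divr_gt0.
have qd : q < d by rewrite gt_min orbC ltr_pdivrMr// mulr2n mulrDr mulr1 ltrDr d0.
exists (k q + k d); first by rewrite addr_ge0// k_ge0// gt_eqF.
move=> s rs.
have -> : k s = k `|s|.
  by case: (ger0P s).
have qs : q <= `|s| by apply: le_trans rs; rewrite ge_min lexx.
have [sd|sd|->] := ltgtP `|s| d.
- by rewrite (le_trans (kD _ _ q0 qs sd))// lerDl k_ge0// gt_eqF.
- by rewrite ks// addr_ge0// k_ge0// gt_eqF.
- by rewrite lerDr k_ge0// gt_eqF.
Qed.

(** The difference between the increment of the weight and its linear part is an
    integral over the thin shell where [|s|] is within [|z - x|] of [x]; on it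
    the integrand is [O(|z - x|)], because the kernel is bounded away from [0]. *)
Lemma weight_derive (x : R) : 0 < d -> 0 < x ->
  is_derive x 1 (weight k) (far_moment k 1 x).
Proof.
move=> d0 x0; have x20 : 0 < x / 2 by rewrite divr_gt0.
have [M M0 kM] := bounded_away d0 x20.
apply: (is_derive_quadratic (C := 8 * x * M) x20) => z zx.
have z0 : 0 < z.
  by move: zx; rewrite ler_norml => /andP[h1 h2]; lra.
pose eta : R := `|z - x|.
have eta0 : 0 <= eta by exact: normr_ge0.
pose I1 := \1_(`[x - eta, x + eta]%classic) : R -> R.
pose I2 := \1_(`[- x - eta, - x + eta]%classic) : R -> R.
have iI (a b : R) : mu.-integrable setT (EFin \o \1_(`[a, b]%classic)).
  apply: integrable_indic_itv.
have eI (a b : R) : a <= b -> \int[mu]_s (\1_(`[a, b]%classic) s) = b - a.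
  move=> ab; rewrite /Rintegral integral_indic// setIT.
  apply: (etrans (congr1 fine (lebesgue_measure_itv `[a, b]%R))).
  by rewrite /= lte_fin; case: ltgtP ab => //= -> _; rewrite subrr.
have iz := weight_integrable (ltW z0).
have ix := weight_integrable (ltW x0).
have i1 := far_moment_integrable (isT : (1 <= 2)%N) x0.
rewrite farE (mulrC _ (z - x)) -RintegralZl// -RintegralB// -RintegralB//; last 2 first.
- exact: integrable_sub.
- exact: integrable_scale.
have -> : 8 * x * M * (z - x) ^+ 2 =
    \int[mu]_s ((2 * x * M * eta) * (I1 s + I2 s)).
  rewrite RintegralZl//; last by apply: integrable_add => //; exact: iI.
  rewrite RintegralD//; try exact: iI; rewrite !eI; try lra.
  by rewrite -(real_normK (num_real (z - x))) -/eta; ring.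
set G := (fun s => _ - _ in X in `|X|).
have iG : mu.-integrable setT (EFin \o G).
  by apply: integrable_sub => //; [exact: integrable_sub|exact: integrable_scale].
(* [`|s| * B `|s|] is the integrand without the kernel *)
pose B (r : R) := Num.min r z - Num.min r x - (z - x) * (x < r)%R%:R.
have [e1 e2] : z - x <= eta /\ x - z <= eta.
  by rewrite /eta ler_norm -normrN opprB ler_norm.
have ex : eta <= x / 2 by [].
have B_le r : `|B r| <= eta.
  rewrite /B; case: (lerP r z) => rz; case: (lerP r x) => rx;
    rewrite ?mulr1 ?mulr0 ?subrr ?subr0 ?normr0// ler_norml; apply/andP; split; lra.
have B_eq0 r : ~~ (x - eta <= r <= x + eta) -> B r = 0.
  rewrite negb_and -!ltNge /B; case: (lerP r z) => rz; case: (lerP r x) => rx;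
    rewrite ?mulr1 ?mulr0; move=> /orP[h|h]; lra.
have GE s : G s = k s * (`|s| * B `|s|).
  rewrite /G far_patchE expr1 /B -(real_normK (num_real s)).
  have := normr_ge0 s; set r := `|s| => r0.
  have mE c : Num.min (r ^+ 2) (c * r) = r * Num.min r c.
    by rewrite minr_pMr// expr2 [c * r]mulrC.
  by rewrite !mE; case: ifP => _ /=; ring.
apply: (le_trans (le_normr_Rintegral measurableT iG)).
apply: le_Rintegral => //.
- by have := integrable_norm iG.
- by apply: integrable_scale => //; apply: integrable_add => //; exact: iI.
move=> s _; rewrite GE.
have c0 : 0 <= 2 * x * M * eta by rewrite !mulr_ge0// ltW.
have J0 : 0 <= I1 s + I2 s by rewrite addr_ge0// /I1 /I2 indicE.
have [rx|rx] := boolP (x - eta <= `|s| <= x + eta); last first.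
  by rewrite B_eq0// !mulr0 normr0 mulr_ge0.
have s0 : s != 0 by rewrite -normr_gt0; case/andP: rx => rx _; lra.
have J1 : 1 <= I1 s + I2 s.
  rewrite /I1 /I2 !indicE !mem_setE !in_itv/=.
  case: (ger0P s) rx => _ rx; first by rewrite rx lerDl.
  have -> : - x - eta <= s <= - x + eta by case/andP: rx => ? ?; apply/andP; split; lra.
  by rewrite lerDr.
apply: le_trans (ler_peMr c0 J1).
rewrite !normrM normr_id (ger0_norm (k_ge0 s0)).
have -> : 2 * x * M * eta = M * (2 * x * eta) by ring.
case/andP: rx => rx1 rx2.
by apply: ler_pM; [exact: k_ge0|exact: mulr_ge0|apply: kM; lra|apply: ler_pM => //; lra].
Qed.

(** Dominated convergence along [x = 1 / (n + 1)], with [k s * s ^ 2] as the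
    dominating function; monotonicity then covers all small [x]. *)
Lemma weight_vanishes (e : R) : 0 < e ->
  exists2 x0, 0 < x0 & forall x, 0 < x -> x <= x0 -> weight k x <= e.
Proof.
move=> e0.
pose f_ (n : nat) (s : R) := (k s * Num.min (s ^+ 2) (n.+1%:R^-1 * `|s|))%:E.
have n0 n : 0 < (n.+1%:R^-1 : R) by rewrite invr_gt0.
have [] := @dominated_convergence _ _ _ mu setT measurableT f_ (cst 0%E)
  (EFin \o (fun s => k s * s ^+ 2)).
- by move=> n; exact: (measurable_int mu (weight_integrable (ltW (n0 n)))).
- exact: measurable_cst.
- apply: aeW => s _; rewrite /f_.
  apply: cvg_EFin; first by near=> n.
  apply/cvgr0Pnorm_le => r r0.
  have q0 : 0 < r / (`|k s| * `|s| + 1) by rewrite divr_gt0// ltr_wpDl// mulr_ge0.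
  near=> n.
  have hn : n.+1%:R^-1 <= r / (`|k s| * `|s| + 1).
    apply: le_trans (ler_norm _) _; near: n.
    exact: (cvgr0_norm_le _ (@cvg_harmonic R) _ q0).
  rewrite /=.
  rewrite normrM [`|Num.min _ _|]ger0_norm; last by apply: m_ge0; exact: ltW.
  apply: (@le_trans _ _ (`|k s| * (n.+1%:R^-1 * `|s|))).
    by rewrite ler_wpM2l// ge_min lexx orbT.
  move: hn; rewrite ler_pdivlMr ?ltr_wpDl ?mulr_ge0//; apply: le_trans.
  by rewrite mulrCA ler_wpM2l ?invr_ge0// lerDl.
- exact: i2.
- apply: aeW => s n _; rewrite /f_ /= lee_fin -/(m n.+1%:R^-1 s) ger0_norm.
    apply: k_ler; first by move=> ->; rewrite m0 expr0n.
    by rewrite /m ge_min lexx.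
  by apply: kM_ge0; [move=> ->; exact: m0|apply: m_ge0; exact: ltW].
move=> _ _; rewrite integral0 => cv.
have {}cv : weight k n.+1%:R^-1 @[n --> \oo] --> 0.
  by have /fine_cvg := cv.
have [N _ HN] := cvgr0_norm_le _ cv _ e0.
exists N.+1%:R^-1 => // x x0 xN.
apply: (le_trans (weight_nondecreasing (ltW x0) xN)).
by apply: le_trans (HN N (leqnn _)); exact: ler_norm.
Unshelve. all: by end_near. Qed.

End weight.

(** * The closed form of [omega] *)

Lemma lebesgue_measure_stretch {R : realType} (x r : R) : 0 < x -> 0 < r ->
  lebesgue_measure ([set t : R | 0 < t <= 1 /\ r * t < x] : set (measurableTypeR R)) =
  (Num.min 1 (x / r))%:E.
Proof.
move=> x0 r0; have xr0 : 0 < x / r by rewrite divr_gt0.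
have [rx|rx] := ltP r x.
  rewrite (_ : [set _ | _] = `]0, 1]%classic); last first.
    apply/seteqP; split => t /=; rewrite in_itv/=; first by case.
    by move=> /[dup] ? /andP[t0 t1]; split => //; nra.
  rewrite lebesgue_measure_itv/= lte_fin ltr01 -EFinB subr0 min_l//.
  by rewrite ler_pdivlMr// mul1r ltW.
rewrite (_ : [set _ | _] = `]0, (x / r)[%classic); last first.
  apply/seteqP; split => t /=; rewrite in_itv/= ltr_pdivlMr//.
    by move=> [/andP[-> _] h]; rewrite mulrC.
  move=> /andP[t0 h]; rewrite mulrC; split => //; rewrite t0/=; nra.
rewrite lebesgue_measure_itv/= lte_fin xr0 -EFinB subr0 min_r//.
by rewrite ler_pdivrMr// mul1r.
Qed.

(** By Tonelli the order of integration can be exchanged; for fixed [s] the set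
    of [t] in ]0, 1] with [|s| * t < x] has measure [min 1 (x / |s|)]. *)
Lemma omegaE {R : realType} (gamma : R -> R) (d x : R) :
  horizon_kernel d (scaled_kernel gamma d) -> 0 < x ->
  omega gamma d x = weight (scaled_kernel gamma d) x.
Proof.
move=> hk x0; set k := scaled_kernel gamma d in hk *.
have k0 s : s != 0 -> 0 <= k s by case: hk => _ + _ _ _; exact.
have mk : measurable_fun setT k by case: hk => _ _ _ _ [].
pose h s : R := k s * s ^+ 2.
have h0 s : 0 <= h s.
  rewrite /h; have [->|s0] := eqVneq s 0; first by rewrite expr0n mulr0.
  by rewrite mulr_ge0 ?k0// sqr_ge0.
have ih : lebesgue_measure.-integrable setT (EFin \o h).
  have := second_moment_integrable hk 0.
  by congr (integrable _ _ _); apply/funext => s /=; rewrite subr0.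
have mh : measurable_fun [set: measurableTypeR R] h.
  by apply/measurable_EFinP; exact: (measurable_int _ ih).
pose A : set (measurableTypeR R * measurableTypeR R) :=
  [set z | 0 < z.1 <= 1 /\ `|z.2| * z.1 < x].
have mA : measurable A.
  rewrite (_ : A = ((fun z : measurableTypeR R * measurableTypeR R => z.1) @^-1` `]0, 1]) `&`
     ((fun z : measurableTypeR R * measurableTypeR R => `|z.2| * z.1) @^-1` `]-oo, x[)); last first.
    by apply/seteqP; split => z /=; rewrite !in_itv.
  apply: measurableI.
    by rewrite -[X in measurable X]setTI; apply: measurable_fst.
  rewrite -[X in measurable X]setTI.
  have : measurable_fun setT (fun z : measurableTypeR R * measurableTypeR R => `|z.2| * z.1).
    by apply: measurable_funM => //; apply: measurableT_comp.
  by apply.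
pose f z : \bar R := (\1_A z * h z.2)%:E.
have mf : measurable_fun setT f.
  apply/measurable_EFinP; apply: measurable_funM; first exact: measurable_indic.
  by apply: measurableT_comp => //; exact: mh.
have f0 z : (0 <= f z)%E by rewrite lee_fin mulr_ge0.
rewrite /omega /weight /Rintegral; congr fine.
transitivity (\int[lebesgue_measure]_t \int[lebesgue_measure]_s f (t, s))%E.
  rewrite integral_mkcond; apply: eq_integral => t _.
  rewrite patchE mem_setE /= in_itv/=; case: ifPn => [t01|t01]; last first.
    apply/esym; apply: integral0_eq => s _; rewrite /f indicE.
    rewrite (_ : _ \in A = false) ?mul0r//; apply/negbTE; rewrite notin_setE /A/=.
    by move=> [h1 _]; rewrite h1 in t01.
  have t0 : 0 < t by case/andP: t01.
  have mD : measurable [set s : R | `|s| < x / t].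
    rewrite (_ : [set _ | _] = `](- (x / t)), (x / t)[%classic); first exact: measurable_itv.
    by apply/seteqP; split => s /=; rewrite in_itv/= ltr_norml.
  rewrite fineK; last first.
    apply: integrable_fin_num => //.
    have : lebesgue_measure.-integrable [set s : R | `|s| < x / t] (EFin \o h).
      by apply: (integrableS measurableT).
    by congr (integrable _ _ _); apply/funext => s /=; rewrite /h real_normK ?num_real// mulrC.
  rewrite integral_mkcond; apply: eq_integral => s _.
  rewrite patchE; set b := (s \in _).
  have -> : b = (`|s| < x / t) by rewrite /b; apply/idP/idP; rewrite inE.
  rewrite /f indicE /h -/k real_normK ?num_real// (mulrC (s ^+ 2)).
  have -> : (t, s) \in A = (`|s| < x / t).
    rewrite ltr_pdivlMr//; apply/idP/idP; rewrite inE /A/=; first by case.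
    by [].
  by case: ifP => _; rewrite /= ?mul1r ?mul0r.
rewrite (@fubini_tonelli _ _ _ _ _ lebesgue_measure lebesgue_measure f mf f0).
apply: eq_integral => s _.
have mY : measurable (ysection A s) by exact: measurable_ysection.
have -> : (fun t => f (t, s)) = (fun t => (h s)%:E * (\1_(ysection A s) t)%:E)%E.
  apply/funext => t; rewrite /f mulrC EFinM !indicE; congr (_ * (_%:R)%:E)%E.
  by rewrite /ysection/= mem_setE.
rewrite ge0_integralZl//; [|by apply/measurable_EFinP; exact: measurable_indic|exact: h0].
rewrite integral_indic// setIT.
have -> : ysection A s = [set t : R | 0 < t <= 1 /\ `|s| * t < x].
  by apply/seteqP; split => t; rewrite /ysection/= inE.
have [s0|s0] := eqVneq s 0.
  by rewrite /h s0 normr0 expr0n !mulr0 mul0e minxx mulr0.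
have r0 : 0 < `|s| by rewrite normr_gt0.
transitivity ((h s)%:E * (Num.min 1 (x / `|s|))%:E)%E.
  by congr (_ * _)%E; exact: lebesgue_measure_stretch.
rewrite -EFinM /h -mulrA minr_pMr ?sqr_ge0// mulr1.
congr (_ * Num.min _ _)%:E.
by rewrite -(real_normK (num_real s)); field; rewrite gt_eqF.
Qed.

(** * Calculus on the line *)

Lemma is_derive_parabola {R : realType} (P a x y : R) :
  is_derive y 1 (fun z => P * (z - x) + a / 2 * (z - x) ^+ 2) (P + a * (y - x)).
Proof.
apply: (is_derive_quadratic (C := `|a / 2|) ltr01) => z _.
rewrite [X in `|X|](_ : _ = a / 2 * (z - y) ^+ 2); last by field.
by rewrite normrM [X in _ * X]ger0_norm// sqr_ge0.
Qed.

Lemma is_derive_affine {R : realType} (P a x y : R) :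
  is_derive y 1 (fun z => P + a * (z - x)) a.
Proof.
apply: (is_derive_quadratic (C := 0) ltr01) => z _.
rewrite mul0r [X in `|X|](_ : _ = 0) ?normr0//; ring.
Qed.

Lemma mean_value_bound {R : realType} (f df : R -> R) (a b C : R) : a <= b ->
  (forall x, a < x < b -> is_derive x 1 f (df x)) ->
  {within `[a, b], continuous f} -> (forall x, a < x < b -> `|df x| <= C) ->
  `|f b - f a| <= C * (b - a).
Proof.
rewrite le_eqVlt => /predU1P[->|ab] fdf cf dfC; first by rewrite !subrr normr0 mulr0.
have fdf' x : x \in `]a, b[ -> is_derive x 1 f (df x) by rewrite in_itv; exact: fdf.
have [c /[!in_itv]/= cab ->] := MVT ab fdf' cf.
by rewrite normrM (gtr0_norm (_ : 0 < b - a)) ?subr_gt0// ler_pM2r ?subr_gt0// dfC.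
Qed.

(** The second-order test at a maximum, in the form needed at an interior maximum
    point of [h] minus a smooth function known only through a parabola above
    it: if [l > a], then the derivative of the difference is positive just to
    the right of [x], and the difference would exceed its value at [x]. *)
Lemma touching_parabola {R : realType} (h h1 : R -> R) (x r l P a : R) : 0 < r ->
  (forall y, `|y - x| < r -> is_derive y 1 h (h1 y)) -> is_derive x 1 h1 l ->
  (forall y, `|y - x| < r -> h y <= h x + P * (y - x) + a / 2 * (y - x) ^+ 2) ->
  h1 x = P /\ l <= a.
Proof.
move=> r0 hd h1d hle.
pose q y := h y - (P * (y - x) + a / 2 * (y - x) ^+ 2).
pose q1 y := h1 y - (P + a * (y - x)).
have qd y : `|y - x| < r -> is_derive y 1 q (q1 y).
  by move=> /hd hy; exact: (is_deriveB hy (is_derive_parabola P a x y)).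
have q1d : is_derive x 1 q1 (l - a).
  exact: (is_deriveB h1d (is_derive_affine P a x x)).
have qx : q x = h x by rewrite /q subrr; ring.
have qmax y : `|y - x| < r -> q y <= q x.
  by move=> /hle; rewrite qx /q; lra.
have itv y : y \in `](x - r), (x + r)[ -> `|y - x| < r.
  by rewrite in_itv/= ltr_norml => /andP[? ?]; apply/andP; split; lra.
have q1x : q1 x = 0.
  have xr : `|x - x| < r by rewrite subrr normr0.
  have : is_derive x 1 q 0.
    apply: (@derive1_at_max _ q (x - r) (x + r)).
    - lra.
    - by move=> t /itv /qd.
    - by rewrite in_itv/=; apply/andP; split; lra.
    - by move=> t /itv; exact: qmax.
  move=> q0; have := qd _ xr => qx1.
  by rewrite -(@derive_val _ _ _ _ _ _ _ qx1) (@derive_val _ _ _ _ _ _ _ q0).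
split; first by move: q1x; rewrite /q1 subrr; lra.
rewrite leNgt; apply/negP => al.
have la : 0 < l - a by rewrite subr_gt0.
have [dq1 lq1] := q1d.
have /cvgrPdist_lt/(_ _ la) : (fun e => e^-1 *: (q1 (e *: 1 + x) - q1 x)) @ 0^' --> l - a.
  by rewrite -lq1; exact: dq1.
move=> /nbhs_ballP [rho /= rho0 Hrho].
have q1pos c : x < c -> c < x + rho -> 0 < q1 c.
  move=> xc crho; have cx0 : 0 < c - x by lra.
  have cx : c - x != 0 by rewrite gt_eqF.
  have := Hrho (c - x); rewrite /ball/= sub0r normrN (gtr0_norm cx0).
  rewrite ltrBlDl => /(_ crho cx); rewrite [_ *: 1]mulr1 subrK q1x subr0.
  rewrite -[_ *: _]/(_ * _) ltr_norml => /andP[_ slope].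
  have ci : 0 < (c - x)^-1 by rewrite invr_gt0.
  have : 0 < (c - x)^-1 * q1 c by lra.
  by rewrite pmulr_rgt0.
pose y := x + Num.min rho r / 2.
have m0 : 0 < Num.min rho r by rewrite lt_min rho0.
have [mr mrho] : Num.min rho r <= rho /\ Num.min rho r <= r.
  by rewrite !ge_min !lexx orbT.
have xy : x < y by rewrite /y; lra.
have yx : `|y - x| < r by rewrite /y ltr_norml; apply/andP; split; lra.
have near_x c : x <= c -> c <= y -> `|c - x| < r.
  by move=> ? ?; apply: le_lt_trans yx; rewrite !ger0_norm; lra.
have qd' c : c \in `]x, y[ -> is_derive c 1 q (q1 c).
  by rewrite in_itv/= => /andP[/ltW xc /ltW cy]; apply: qd; exact: near_x.
have qc : {within `[x, y], continuous q}.
  apply: derivable_within_continuous => c /[!in_itv]/= /andP[xc cy].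
  by have [] := qd _ (near_x _ xc cy).
have [t /[!in_itv]/= /andP[xt ty] E] := MVT xy qd' qc.
have := qmax _ yx; have := q1pos t xt; move: E ty; rewrite /y => E ty.
have txr : t < x + rho by lra.
move=> /(_ txr) q1t qyx; have : 0 < q1 t * (x + Num.min rho r / 2 - x).
  by apply: mulr_gt0 => //; lra.
by move: qyx; rewrite /y; lra.
Qed.

Lemma mean_value_ball {R : realType} (f df : R -> R) (a b x r C : R) : a < x < b ->
  (forall c : R, a < c < b -> `|c - x| <= r -> is_derive c 1 f (df c)) ->
  (forall c : R, a < c < b -> `|c - x| <= r -> `|df c| <= C) ->
  forall y : R, a < y < b -> `|y - x| <= r -> `|f y - f x| <= C * `|y - x|.
Proof.
move=> /andP[ax xb] fd fC y /andP[ay yb].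
have dc (s t : R) : (forall c : R, s <= c <= t -> is_derive c 1 f (df c)) ->
    {within `[s, t], continuous f}.
  by move=> st; apply: derivable_within_continuous => c /[!in_itv]/= /st[].
have [xy|yx] := lerP x y => yr.
  have inb (c : R) : x <= c <= y -> a < c < b /\ `|c - x| <= r.
    move=> /andP[xc cy]; split; first by apply/andP; split; lra.
    by rewrite ger0_norm; lra.
  apply: mean_value_bound => // [c /andP[/ltW xc /ltW cy]||c /andP[/ltW xc /ltW cy]].
  - by have [] := inb c; [rewrite xc|exact: fd].
  - by apply: dc => c /inb[]; exact: fd.
  - by have [] := inb c; [rewrite xc|exact: fC].
have inb (c : R) : y <= c <= x -> a < c < b /\ `|c - x| <= r.
  move=> /andP[yc cx]; split; first by apply/andP; split; lra.
  by rewrite ler0_norm; lra.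
rewrite distrC.
apply: (mean_value_bound (ltW yx)) => // [c /andP[/ltW yc /ltW cx]||c /andP[/ltW yc /ltW cx]].
- by have [] := inb c; [rewrite yc|exact: fd].
- by apply: dc => c /inb[]; exact: fd.
- by have [] := inb c; [rewrite yc|exact: fC].
Qed.

(** Three applications of the mean value inequality. The constant is not sharp
    (a factor [1 / 6] is lost), which costs nothing here. *)
Lemma taylor2_bound {R : realType} (f f1 f2 f3 : R -> R) (a b M : R) :
  (forall c : R, a < c < b -> is_derive c 1 f (f1 c)) ->
  (forall c : R, a < c < b -> is_derive c 1 f1 (f2 c)) ->
  (forall c : R, a < c < b -> is_derive c 1 f2 (f3 c)) ->
  (forall c : R, a < c < b -> `|f3 c| <= M) ->
  forall x y : R, a < x < b -> a < y < b ->
  `|f y - (f x + f1 x * (y - x) + f2 x / 2 * (y - x) ^+ 2)| <= M * `|y - x| ^+ 3.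
Proof.
move=> D1 D2 D3 B3 x y xab yab; set r := `|y - x|.
have M0 : 0 <= M by apply: le_trans (B3 _ xab).
have r0 : 0 <= r by exact: normr_ge0.
have S2 (c : R) : a < c < b -> `|c - x| <= r -> `|f2 c - f2 x| <= M * r.
  move=> cab cr; apply: (@le_trans _ _ (M * `|c - x|)); last by rewrite ler_wpM2l.
  apply: (mean_value_ball (df := f3) (r := r) xab) => // t tab _; first exact: D3.
  exact: B3.
pose q1 (c : R) := f1 c - (f1 x + f2 x * (c - x)).
have S1 (c : R) : a < c < b -> `|c - x| <= r -> `|q1 c| <= M * r ^+ 2.
  move=> cab cr; have -> : q1 c = q1 c - q1 x by rewrite /q1 subrr; ring.
  apply: (@le_trans _ _ (M * r * `|c - x|)); last first.
    by rewrite expr2 mulrA ler_wpM2l// mulr_ge0.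
  apply: (mean_value_ball (df := fun c => f2 c - f2 x) (r := r) xab) => // t tab _.
  exact: (is_deriveB (D2 _ tab) (is_derive_affine (f1 x) (f2 x) x t)).
pose q (c : R) := f c - (f1 x * (c - x) + f2 x / 2 * (c - x) ^+ 2).
have -> : f y - (f x + f1 x * (y - x) + f2 x / 2 * (y - x) ^+ 2) = q y - q x.
  by rewrite /q subrr; ring.
have -> : M * r ^+ 3 = M * r ^+ 2 * `|y - x| by rewrite -/r; ring.
apply: (mean_value_ball (df := q1) (r := r) xab) => // t tab _.
exact: (is_deriveB (D1 _ tab) (is_derive_parabola (f1 x) (f2 x) x t)).
Qed.

Lemma bounded_on_segment {R : realType} (a b : R) (h : R -> R) : a <= b ->
  {within `[a, b], continuous h} ->
  exists M : R, forall x : R, a <= x <= b -> `|h x| <= M.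
Proof.
move=> ab ch; have [s _ Hs] := EVT_max ab ch; have [t _ Ht] := EVT_min ab ch.
exists (`|h s| + `|h t|) => x xab.
have xab' : x \in `[a, b] by rewrite in_itv.
have := Hs _ xab'; have := Ht _ xab'; have := ler_norm (h s).
have := ler_norm (- h t); have := normr_ge0 (h s); have := normr_ge0 (h t).
by rewrite normrN => ? ? ? ? ? ?; rewrite ler_norml; apply/andP; split; lra.
Qed.

(** * The quasinonlocal equation, unfolded *)

(** What a strong solution [u] of the problem with right-hand side [- F] provides,
    without default values and with the derivatives [g1], [g2] of its smooth
    part [g] made explicit. In this form the information is visibly stable under
    negation, so that a bound from above is enough. [p] is the slope of [g] at
    [0+]; [qnl_C2] records the modulus with which [g] follows it, the only
    information available up to the interface. *)
Record qnl_data {R : realType} (k : R -> R) (d : R) (F u g g1 g2 : R -> R)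
    (p C : R) : Prop := QnlData {
  qnl_left : {within `[-1 - d, 0], continuous u};
  qnl_right : {within `[0, 1], continuous g};
  qnl_glue : forall x : R, 0 < x <= 1 -> u x = g x;
  qnl_outer : forall x : R, -1 - d < x < -1 -> u x = 0;
  qnl_end : u 1 = 0;
  qnl_g1 : forall x : R, 0 < x < 1 -> is_derive x 1 g (g1 x);
  qnl_g2 : forall x : R, 0 < x < 1 -> is_derive x 1 g1 (g2 x);
  qnl_C2 : forall x : R, 0 < x < 1 ->
    [/\ `|g2 x| <= C, `|g1 x - p| <= C * x
      & `|g x - g 0 - p * x| <= C * x ^+ 2];
  qnl_nonlocal : forall x : R, -1 < x <= 0 ->
    (forall e : R, 0 < e -> (@lebesgue_measure R).-integrable [set y : R | e < `|y - x|]
       (EFin \o (fun y => k (y - x) * (u y - u x)))) /\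
    (\int[lebesgue_measure]_(y in [set y : R | e < `|y - x|])
       (k (y - x) * (u y - u x))) @[e --> 0^'+] --> F x / 2;
  qnl_transition : forall x : R, 0 < x <= d ->
    (@lebesgue_measure R).-integrable [set y : R | y < 0]
       (EFin \o (fun y => k (y - x) * (u y - u x))) /\
    2 * (\int[lebesgue_measure]_(y in [set y : R | y < 0]) (k (y - x) * (u y - u x)))
      + (weight k x * g2 x + far_moment k 1 x * g1 x) = F x;
  qnl_local : forall x : R, d < x < 1 -> g2 x = F x
}.

Lemma qnl_dataN {R : realType} (k : R -> R) (d : R) (F u g g1 g2 : R -> R) (p C : R) :
  qnl_data k d F u g g1 g2 p C ->
  qnl_data k d (fun x => - F x) (fun x => - u x) (fun x => - g x)
    (fun x => - g1 x) (fun x => - g2 x) (- p) C.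
Proof.
have E (x : R) (v : R -> R) (y : R) : k (y - x) * (- v y - - v x) = -1 * (k (y - x) * (v y - v x)) by ring.
case=> H1 H2 H3 H4 H5 H6 H7 H8 H9 H10 H11; split.
- by move=> x; apply: continuousN; exact: H1.
- by move=> x; apply: continuousN; exact: H2.
- by move=> x /H3 ->.
- by move=> x /H4 ->; rewrite oppr0.
- by rewrite H5 oppr0.
- by move=> x /H6 h; exact: is_deriveN.
- by move=> x /H7 h; exact: is_deriveN.
- move=> x /H8[h1 h2 h3]; split; first by rewrite normrN.
    by rewrite -normrN; congr (`|_| <= _): h2; ring.
  by rewrite -normrN; congr (`|_| <= _): h3; ring.
- move=> x /H9[i c]; split.
    move=> e /i ie; have := integrable_scale (measurable_far x e) (-1) ie.
    by congr (integrable _ _ _); apply/funext => y /=; rewrite -E.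
  rewrite mulNr; apply: cvg_trans (cvgN c).
  apply: near_eq_cvg; near=> e.
  have e0 : 0 < e by near: e; exact: nbhs_right_gt.
  rewrite -[LHS]mulN1r -RintegralZl//; [|exact: measurable_far|exact: i].
  by apply: eq_Rintegral => y _; rewrite -E.
- have mE : measurable [set y : R | y < 0] by rewrite -set_itvNyo; exact: measurable_itv.
  move=> x /H10[i h]; split.
    have := integrable_scale mE (-1) i.
    by congr (integrable _ _ _); apply/funext => y /=; rewrite -E.
  under eq_Rintegral do rewrite E.
  by rewrite RintegralZl// -h; ring.
- by move=> x /H11 ->.
Unshelve. all: by end_near. Qed.

(** The estimates at [0+] come from the mean value theorem applied to the
    continuous extension of the first derivative. *)
Lemma Ck_closed_data {R : realType} (g : R -> R) : Ck_closed 2 0 1 g ->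
  exists p C : R, [/\ forall x : R, 0 < x < 1 -> is_derive x 1 g ((derive1 g) x),
    forall x : R, 0 < x < 1 -> is_derive x 1 (derive1 g) (derive1n 2 g x)
    & forall x : R, 0 < x < 1 ->
    [/\ `|derive1n 2 g x| <= C, `|(derive1 g) x - p| <= C * x
      & `|g x - g 0 - p * x| <= C * x ^+ 2] ].
Proof.
move=> [cg dg hg].
have D1 (x : R) : 0 < x < 1 -> is_derive x 1 g ((derive1 g) x).
  by move=> x01; rewrite derive1E; apply/derivableP; exact: (dg 0%N).
have D2 (x : R) : 0 < x < 1 -> is_derive x 1 (derive1 g) (derive1n 2 g x).
  move=> x01; rewrite derive1nS derive1E; apply/derivableP; exact: (dg 1%N).
have [h1 [ch1 eh1]] := hg 1%N isT.
have {}eh1 (x : R) : 0 < x < 1 -> derive1 g x = h1 x by exact: eh1.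
have [h2 [ch2 eh2]] := hg 2%N isT.
have [C HC] : exists C, forall x : R, 0 < x < 1 -> `|derive1n 2 g x| <= C.
  have [C HC] := bounded_on_segment ler01 ch2; exists C => x x01; rewrite eh2//.
  by apply: HC; case/andP: x01 => /ltW -> /ltW ->.
have sub (f : R -> R) (x : R) : 0 < x < 1 -> {within `[0, 1], continuous f} -> {within `[0, x], continuous f}.
  move=> /andP[x0 x1]; apply: continuous_subspaceW => y /=; rewrite !in_itv/=.
  by move=> /andP[-> yx]; exact: le_trans yx (ltW x1).
have H1 (x : R) : 0 < x < 1 -> `|(derive1 g) x - h1 0| <= C * x.
  move=> x01; have /andP[x0 x1] := x01.
  rewrite (eh1 _ x01) -[X in _ * X]subr0.
  apply: (@mean_value_bound _ h1 (derive1n 2 g)); first exact: ltW.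
  - move=> c /andP[c0 cx]; have c01 : 0 < c < 1 by rewrite c0/= (lt_trans cx).
    apply: near_eq_is_derive (D2 _ c01); near=> y; apply: eh1.
    apply/andP; split; [near: y; exact: lt_nbhsr|near: y; apply: lt_nbhsl; lra].
  - exact: sub.
  - by move=> c /andP[c0 cx]; apply: HC; rewrite c0/= (lt_trans cx).
exists (h1 0), C; split=> // x x01; split; [exact: HC|exact: H1|].
have /andP[x0 x1] := x01.
have gd' (c : R) : c \in `]0, x[ -> is_derive c 1 g ((derive1 g) c).
  by rewrite in_itv/= => /andP[c0 cx]; apply: D1; rewrite c0/= (lt_trans cx).
have [c /[!in_itv]/= /andP[c0 cx] ->] := MVT x0 gd' (sub _ _ x01 cg).
rewrite subr0 -mulrBl normrM (gtr0_norm x0) expr2 mulrA ler_pM2r//.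
have C0 : 0 <= C by apply: le_trans (HC _ x01).
have c01 : 0 < c < 1 by rewrite c0/= (lt_trans cx).
by apply: (le_trans (H1 _ c01)); rewrite ler_wpM2l// ltW.
Unshelve. all: by end_near. Qed.

Lemma qnl_strong_solution_data {R : realType} (gamma f u : R -> R) (d : R) :
  admissible_kernel gamma -> 0 < d < 1 -> qnl_strong_solution gamma d f u ->
  exists g g1 g2 p C,
    qnl_data (scaled_kernel gamma d) d (fun x => - f x) u g g1 g2 p C.
Proof.
move=> hg /andP[d0 d1] [cu [g [Cg ug]] hL hout u1].
have hk := scaled_kernelP hg d0.
have [p [C [D1 D2 B]]] := Ck_closed_data Cg.
have cg : {within `[0, 1], continuous g} by case: Cg.
have near_u (x : R) : 0 < x < 1 -> \forall y \near x, g y = u y.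
  move=> /andP[x0 x1]; near=> y; apply/esym/ug; apply/andP; split.
    by near: y; exact: lt_nbhsr.
  by apply: ltW; near: y; exact: lt_nbhsl.
have near_u1 (x : R) : 0 < x < 1 -> \forall y \near x, (derive1 g) y = (derive1 u) y.
  move=> /andP[x0 x1]; near=> y.
  have y01 : 0 < y < 1.
    by apply/andP; split; [near: y; exact: lt_nbhsr|near: y; apply: lt_nbhsl; lra].
  rewrite [RHS]derive1E; have := near_eq_is_derive (near_u _ y01) (D1 _ y01).
  by move=> h; rewrite (@derive_val _ _ _ _ _ _ _ h).
exists g, (derive1 g), (derive1n 2 g), p, C; split => //.
- move=> x /andP[x1 x0]; have x11 : -1 < x < 1 by rewrite x1 (le_lt_trans x0).
  have [] := hL _ x11; rewrite /Lqnl_defined /Lqnl x0 /pv_integral => -[i c] <-.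
  split; first exact: i.
  by move: c; rewrite opprK mulrAC divff// mul1r => c; exact: c.
- move=> x /andP[x0 xd]; have x01 : 0 < x < 1 by rewrite x0 (le_lt_trans xd).
  have x11 : -1 < x < 1 by apply/andP; split; lra.
  have [] := hL _ x11; rewrite /Lqnl_defined /Lqnl leNgt x0/= xd => -[i _ _] <-.
  split; first exact: i.
  rewrite opprK; congr (_ + _).
  have W := is_deriveM (weight_derive hk d0 x0) (D2 _ x01).
  have {}W : is_derive x 1 (fun z => omega gamma d z * (derive1 u) z)
      (weight (scaled_kernel gamma d) x *: derive1n 2 g x +
       (derive1 g) x *: far_moment (scaled_kernel gamma d) 1 x).
    apply: near_eq_is_derive W; near=> y.
    have y0 : 0 < y by near: y; exact: lt_nbhsr.
    rewrite -[LHS]/(_ * _) (omegaE hk y0); congr (_ * _).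
    by near: y; exact: near_u1.
  rewrite [RHS]derive1E (@derive_val _ _ _ _ _ _ _ W).
  by congr (_ + _); exact: mulrC.
- move=> x /andP[xd x1]; have x0 := lt_trans d0 xd.
  have x01 : 0 < x < 1 by rewrite x0.
  have x11 : -1 < x < 1 by apply/andP; split; lra.
  have [_] := hL _ x11; rewrite /Lqnl leNgt x0/= leNgt xd/= => <-.
  rewrite opprK [RHS]derive1E.
  have W := near_eq_is_derive (near_u1 _ x01) (D2 _ x01).
  by rewrite (@derive_val _ _ _ _ _ _ _ W).
Unshelve. all: by end_near. Qed.

(** * The barrier *)

(** Twice the integral of a ramp that saturates at [2 * d]: strictly convex with
    second derivative [2] on the layer and a neighbourhood of size [d] of it,
    yet of size [O(d)] on bounded sets. *)
Definition huber {R : realType} (d y : R) : R :=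
  if `|y| <= 2 * d then y ^+ 2 else 4 * d * `|y| - 4 * d ^+ 2.

Section huber_lemmas.
Context {R : realType} (d : R).
Hypothesis d0 : 0 < d.

Lemma huber_in (y : R) : `|y| <= 2 * d -> huber d y = y ^+ 2.
Proof. by rewrite /huber => ->. Qed.

Lemma huber_continuous : continuous (huber d).
Proof.
pose n (z : R) := `|z|; pose m (z : R) := Num.min `|z| (2 * d).
rewrite (_ : huber d = m \* (2 \*o n \- m)).
  move=> y; have cn : {for y, continuous n} by exact: norm_continuous.
  have cm : {for y, continuous m}.
    by apply: (@continuous_min _ _ n (cst (2 * d))) => //; exact: cst_continuous.
  apply: continuousM; first exact: cm.
  apply: continuousB; last exact: cm.
  by apply: (@continuousM _ _ (cst 2) n) => //; exact: cst_continuous.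
apply/funext => y; rewrite /huber /m /n /=; case: (lerP `|y| (2 * d)) => yd.
  by rewrite -(real_normK (num_real y)); ring.
by ring.
Qed.

Lemma huber_ge0 (y : R) : 0 <= huber d y.
Proof.
rewrite /huber; case: ifPn => [_|]; first exact: sqr_ge0.
rewrite -ltNge => yd; have : 0 < d * (`|y| - 2 * d) by rewrite mulr_gt0// subr_gt0.
by have := sqr_ge0 d; lra.
Qed.

Lemma huber_le (y : R) : d <= 1 -> `|y| <= 2 -> huber d y <= 8 * d.
Proof.
move=> d1 y2; have h1 : 0 <= d * (2 - `|y|) by rewrite mulr_ge0 ?subr_ge0// ltW.
rewrite /huber; case: ifPn => [yd|_]; last by have := sqr_ge0 d; lra.
have : 0 <= `|y| * (2 * d - `|y|) by rewrite mulr_ge0 ?subr_ge0.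
by rewrite -(real_normK (num_real y)); nra.
Qed.

(* [huber] is the supremum of these lines, the tangents of [y ^ 2] at [m] *)
Let huber_ge_line (m y : R) : `|m| <= 2 * d -> 2 * m * y - m ^+ 2 <= huber d y.
Proof.
rewrite ler_norml => /andP[m1 m2]; rewrite /huber; case: ifPn => [_|].
  by have := sqr_ge0 (y - m); lra.
rewrite -ltNge; case: (ger0P y) => y0 yd.
  have : 0 <= (2 * d - m) * (y - d - m / 2) by apply: mulr_ge0; lra.
  by lra.
have : 0 <= (2 * d + m) * (- y - d + m / 2) by apply: mulr_ge0; lra.
by lra.
Qed.

Lemma huber_convex (x : R) :
  exists q, forall y, huber d x + q * (y - x) <= huber d y.
Proof.
have line (m : R) : `|m| <= 2 * d -> huber d x = 2 * m * x - m ^+ 2 ->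
    exists q, forall y, huber d x + q * (y - x) <= huber d y.
  move=> md hx; exists (2 * m) => y; apply: le_trans (huber_ge_line y md).
  by rewrite hx; lra.
have [xd|xd] := lerP `|x| (2 * d).
  by apply: (line x) => //; rewrite huber_in//; ring.
have hE : huber d x = 4 * d * `|x| - 4 * d ^+ 2 by rewrite /huber leNgt xd.
have n2 : `|2 * d| = 2 * d by rewrite ger0_norm // mulr_ge0 // ltW.
case: (ger0P x) hE => x0 hE.
  by apply: (line (2 * d)); [rewrite n2|rewrite hE; ring].
by apply: (line (- (2 * d))); [rewrite normrN n2|rewrite hE; ring].
Qed.

End huber_lemmas.

(** * Comparison with the barrier *)

Section comparison.
Context {R : realType}.
Variables (k : R -> R) (d p C M2 M3 : R) (F u g g1 g2 U U1 : R -> R).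
Hypothesis hk : horizon_kernel d k.
Hypothesis d01 : 0 < d < 1.
Hypothesis hu : qnl_data k d F u g g1 g2 p C.
Hypothesis cU : {within `[-1 - d, 1], continuous U}.
Hypothesis tU : forall x y : R, -1 < x < 1 -> -1 - d <= y < 1 ->
  U y <= U x + U1 x * (y - x) + F x / 2 * (y - x) ^+ 2 + M3 * `|y - x| ^+ 3.
Hypothesis FM2 : forall x : R, -1 < x < 1 -> `|F x| <= M2.
Hypothesis Uout : forall y : R, -1 - d <= y <= -1 -> U y = 0.
Hypothesis U1_0 : U 1 = 0.
Hypothesis M30 : 0 <= M3.

Let d0 : 0 < d. Proof. by case/andP: d01. Qed.
Let d1 : d < 1. Proof. by case/andP: d01. Qed.

(* [K] absorbs the Taylor remainder of [U], [N] the [O(1)] consistency error in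
   the transition layer *)
Let K := M3 + 1.
Let N := 3 * M2 + 3.

Definition barrier (y : R) : R :=
  K * d * (4 - y ^+ 2) + N * (4 * d - huber d y / 2).

Let Phi y := U y + barrier y.

Let M20 : 0 <= M2.
Proof. by apply: le_trans (normr_ge0 (F 0)) (FM2 _); rewrite ltrN10 ltr01. Qed.

Let K0 : 0 < K. Proof. by move: M30; rewrite /K; lra. Qed.
Let N0 : 0 < N. Proof. by move: M20; rewrite /N; lra. Qed.

Lemma barrier_ge0 (y : R) : -2 <= y <= 2 -> 0 <= barrier y.
Proof.
move=> /andP[y1 y2]; have y4 : y ^+ 2 <= 4.
  by have : 0 <= (2 - y) * (2 + y); [apply: mulr_ge0; lra|lra].
rewrite /barrier addr_ge0// !mulr_ge0 ?(ltW K0) ?(ltW N0) ?(ltW d0) ?subr_ge0//.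
by have := huber_le d0 (ltW d1) (_ : `|y| <= 2); rewrite ler_norml y1 y2 => /(_ isT); have := d0; lra.
Qed.

Lemma barrier_le (y : R) : barrier y <= 4 * (K + N) * d.
Proof.
rewrite /barrier; have := huber_ge0 d0 y; have := sqr_ge0 y => y2 h0.
have -> : 4 * (K + N) * d = K * d * 4 + N * (4 * d) by ring.
by rewrite lerD// ler_wpM2l ?mulr_ge0 ?(ltW K0) ?(ltW N0) ?(ltW d0)//; lra.
Qed.

Lemma barrier_parabola (x : R) : exists q, forall y,
  barrier y <= barrier x + q * (y - x) - K * d * (y - x) ^+ 2.
Proof.
have [q hq] := huber_convex d0 x.
exists (K * d * (- (2 * x)) - N * q / 2) => y.
have := ler_wpM2l (ltW N0) (hq y); rewrite /barrier; lra.
Qed.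

Lemma barrier_parabola_transition (x : R) : 0 <= x <= d -> exists q, forall y,
  `|y - x| <= d ->
  barrier y <= barrier x + q * (y - x) - (K * d + N / 2) * (y - x) ^+ 2.
Proof.
move=> /andP[x0 xd]; exists (K * d * (- (2 * x)) - N * x) => y.
rewrite ler_norml => /andP[y1 y2]; have dp := d0; rewrite /barrier !huber_in.
- lra.
- by rewrite ler_norml; apply/andP; split; lra.
- by rewrite ler_norml; apply/andP; split; lra.
Qed.

(** The comparison function has at every point a parabola above it whose
    curvature [a] is below [F x], and is so far below in the transition layer
    that half of it is still below [- M2]: there the operator returns only a
    fraction of at least [1 / 2] of [a]. *)
Lemma touching_supersolution (x : R) : -1 < x < 1 -> exists P a, [/\
  a <= F x - 2 * d, 0 <= x <= d -> a <= M2 - N &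
  forall y, -1 - d <= y < 1 -> `|y - x| <= d ->
    Phi y <= Phi x + P * (y - x) + a / 2 * (y - x) ^+ 2].
Proof.
have dp := d0; have np := N0.
move=> x1; have cube y : `|y - x| <= d -> M3 * `|y - x| ^+ 3 <= M3 * d * (y - x) ^+ 2.
  move=> yd; rewrite -mulrA ler_wpM2l// exprS real_normK ?num_real//.
  by rewrite ler_wpM2r ?sqr_ge0.
have Fx : F x <= M2 by apply: le_trans (FM2 x1); exact: ler_norm.
have [xd|xd] := boolP (0 <= x <= d).
  have [q hq] := barrier_parabola_transition xd.
  exists (U1 x + q), (F x - 2 * d - N); split; [lra|move=> _; lra|].
  move=> y y1 yd; have := tU x1 y1; have := hq y yd; have := cube y yd.
  by rewrite /Phi /K; lra.
have [q hq] := barrier_parabola x.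
exists (U1 x + q), (F x - 2 * d); split; [lra|by []|].
move=> y y1 yd; have := tU x1 y1; have := hq y; have := cube y yd.
by rewrite /Phi /K; lra.
Qed.


(** The truncated integrals are at most [a / 2 * far_moment k 2 e], whose limit is
    [a / 2 < F x / 2]. *)
Lemma no_touching_nonlocal (x m : R) : -1 < x <= 0 ->
  (forall y, -1 - d <= y < 1 -> u y <= Phi y + m) -> u x = Phi x + m -> False.
Proof.
move=> /andP[x1 x0] hle hx; have dp := d0; have d1' := d1.
have x11 : -1 < x < 1 by apply/andP; split; lra.
have [P [a [aF _ tP]]] := touching_supersolution x11.
have x10 : -1 < x <= 0 by rewrite x1.
have [iI cI] := qnl_nonlocal hu x10.
have eta0 : 0 < d / (2 * (`|a| + 1)) by rewrite divr_gt0// mulr_gt0// ltr_wpDl.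
have [r r0 Wr] := weight_vanishes hk eta0.
have {}cI := cvgr_dist_lt _ _ cI.
have d4 : 0 < d / 4 by rewrite divr_gt0.
have [e [e0 er Ie]] : exists e : R, [/\ 0 < e, e <= r &
    F x / 2 - d / 4 < \int[lebesgue_measure]_(y in [set y : R | e < `|y - x|])
       (k (y - x) * (u y - u x))].
  near (0 : R)^'+ => e; exists e; split.
  - by near: e; exact: nbhs_right_gt.
  - by near: e; apply: nbhs_right_le.
  - have : `|F x / 2 - \int[lebesgue_measure]_(y in [set y : R | e < `|y - x|])
       (k (y - x) * (u y - u x))| < d / 4 by near: e; exact: cI.
    by rewrite ltr_norml => /andP[_]; lra.
have := far_integral_le hk (p := P) (a := a) e0 (iI e e0).
have bound y : e < `|y - x| -> `|y - x| <= d ->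
    u y - u x <= P * (y - x) + a / 2 * (y - x) ^+ 2.
  move=> _ yd; have y1 : -1 - d <= y < 1.
    by move: yd; rewrite ler_norml => /andP[? ?]; apply/andP; split; lra.
  by have := hle _ y1; have := tP _ y1 yd; rewrite hx; lra.
move=> /(_ bound) Ile.
have W1 := far_moment2_ge hk e0; have W2 := far_moment2_le1 hk e0.
have := Wr _ e0 er; rewrite ler_pdivlMr ?mulr_gt0 ?ltr_wpDl// => W3.
have W0 := weight_ge0 hk (ltW e0).
have a1 := ler_norm a; have a2 := ler_norm (- a); rewrite normrN in a2.
set W := weight k e in W0 W1 W3; set mu2 := far_moment k 2 e in W1 W2 Ile.
have : a / 2 * mu2 <= a / 2 + `|a| / 2 * W.
  have : 0 <= (`|a| + a) * (1 - mu2) by apply: mulr_ge0; lra.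
  have : 0 <= `|a| * (W - (1 - mu2)) by apply: mulr_ge0 => //; lra.
  by nra.
by nra.
Unshelve. all: by end_near. Qed.

(** In the transition layer [g1 x] equals the slope of the parabola, hence the
    first moments cancel and [F x <= a * (far_moment k 2 x / 2 + weight k x)];
    the factor is at least [1 / 2] and [a <= 0]. *)
Lemma no_touching_right (x m : R) : 0 < x < 1 ->
  (forall y, -1 - d <= y <= 0 -> u y <= Phi y + m) ->
  (forall y, 0 < y < 1 -> g y <= Phi y + m) -> g x = Phi x + m -> False.
Proof.
move=> /[dup] x01 /andP[x0 x1] hleu hleg hx; have dp := d0; have d1' := d1.
have x11 : -1 < x < 1 by apply/andP; split; lra.
have [P [a [aF aN tP]]] := touching_supersolution x11.
pose r := Num.min d (Num.min x (1 - x)).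
have r0 : 0 < r by rewrite !lt_min dp x0/= subr_gt0.
have [rd rx r1] : [/\ r <= d, r <= x & r <= 1 - x].
  by rewrite !ge_min !lexx !orbT.
have inr y : `|y - x| < r -> [/\ 0 < y < 1, -1 - d <= y < 1 & `|y - x| <= d].
  move=> yr; have := yr; rewrite ltr_norml => /andP[? ?].
  split; [apply/andP; split; lra|apply/andP; split; lra|lra].
have [g1x g2x] : g1 x = P /\ g2 x <= a.
  apply: (touching_parabola r0 _ (qnl_g2 hu x01)).
    by move=> y /inr[y01 _ _]; exact: (qnl_g1 hu).
  move=> y /inr[y01 y1 yd]; have := hleg _ y01; have := tP _ y1 yd.
  by rewrite hx; lra.
have [xd|xd] := lerP x d; last first.
  by have := qnl_local hu (_ : d < x < 1); rewrite xd x1 => /(_ isT); lra.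
have x0d : 0 < x <= d by rewrite x0.
have [iI E] := qnl_transition hu x0d.
have ux : u x = g x by apply: (qnl_glue hu); rewrite x0 ltW.
have bound y : y < 0 -> `|y - x| <= d ->
    u y - u x <= P * (y - x) + a / 2 * (y - x) ^+ 2 + 0.
  move=> y0 yd; have : -1 - d <= y < 1 /\ -1 - d <= y <= 0.
    by move: yd; rewrite ler_norml => /andP[? ?]; split; apply/andP; split; lra.
  by move=> [y1 y2]; have := hleu _ y2; have := tP _ y1 yd; rewrite ux hx; lra.
have := left_integral_le hk x0 iI bound.
have W1 := far_moment2_ge hk x0; have W0 := weight_ge0 hk (ltW x0).
have FM : - M2 <= F x by have := FM2 x11; rewrite ler_norml => /andP[].
have aN' : a <= M2 - N by apply: aN; rewrite (ltW x0).
move: E; rewrite g1x; set W := weight k x in W0 W1 *.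
have : W * g2 x <= W * a by rewrite ler_wpM2l.
set mu2 := far_moment k 2 x in W1 *.
have a0 : a <= - M2 * 2 - 3 by move: aN'; rewrite /N; lra.
have m20 := M20.
have : 0 <= (- a) * (mu2 - (1 - W)) by apply: mulr_ge0; lra.
have : 0 <= (- a) * W by apply: mulr_ge0; lra.
by lra.
Qed.

(** The supremum is approached at [0+] but [u 0] may be smaller, so that no equation
    holds at the maximum itself. For small [x > 0], the parabola at [0] bounds
    [u y - u x] for [y < 0], with the slope [p] of [g] in place of [P]: the
    inequality [p <= P] has the right sign because [y] is negative. The
    equation at [x] then yields [F x <= a / 2 + O(weight k x)]. *)
Lemma no_touching_interface (m : R) :
  (forall y, -1 - d <= y <= 0 -> u y <= Phi y + m) ->
  (forall y, 0 < y < 1 -> g y <= Phi y + m) -> g 0 = Phi 0 + m -> False.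
Proof.
move=> hleu hleg hx; have dp := d0; have d1' := d1; have m20 := M20.
have x11 : -1 < (0 : R) < 1 by rewrite ltrN10 ltr01.
have [P [a [_ aN tP]]] := touching_supersolution x11.
have a0 : a <= - M2 * 2 - 3.
  by have := aN _; rewrite lexx (ltW dp) => /(_ isT); rewrite /N; lra.
have C0 : 0 <= C.
  by have [+ _ _] := qnl_C2 hu d01; apply: le_trans.
have pP : p <= P.
  rewrite leNgt; apply/negP => Pp.
  pose y := Num.min d ((p - P) / (2 * (C + 1))).
  have C1 : 0 < 2 * (C + 1) by lra.
  have y0 : 0 < y by rewrite lt_min dp divr_gt0// subr_gt0.
  have [yd yC] : y <= d /\ y * (2 * (C + 1)) <= p - P.
    by rewrite -ler_pdivlMr// !ge_min !lexx orbT.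
  have y01 : 0 < y < 1 by rewrite y0; lra.
  have [_ _] := qnl_C2 hu y01; rewrite ler_norml => /andP[h _].
  have y1 : -1 - d <= y < 1 by apply/andP; split; lra.
  have yd' : `|y - 0| <= d by rewrite subr0 ger0_norm// ltW.
  have := tP _ y1 yd'; have := hleg _ y01; rewrite subr0 => h1 h2.
  have : 0 <= - a / 2 * y ^+ 2 by rewrite mulr_ge0 ?sqr_ge0//; lra.
  have : 0 <= y * (p - P - y * (2 * (C + 1))) by rewrite mulr_ge0 ?subr_ge0// ltW.
  have : 0 < y * y by rewrite mulr_gt0.
  have : 0 <= C * (y * y) by rewrite !mulr_ge0// ltW.
  by rewrite expr2 in h *; nra.
have eta0 : 0 < (2 * `|a| + 3 * C + 1)^-1 by rewrite invr_gt0 ltr_wpDl// addr_ge0// mulr_ge0.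
have [r r0 Wr] := weight_vanishes hk eta0.
pose x := Num.min r d.
have x0 : 0 < x by rewrite lt_min r0.
have [xr xd] : x <= r /\ x <= d by rewrite !ge_min !lexx orbT.
have x01 : 0 < x < 1 by rewrite x0; lra.
have x1 : -1 < x < 1 by apply/andP; split; lra.
have x0d : 0 < x <= d by rewrite x0.
have [iI E] := qnl_transition hu x0d.
have ux : u x = g x by apply: (qnl_glue hu); case/andP: x01 => -> /ltW.
have [g2x g1x gx] := qnl_C2 hu x01.
have bound y : y < 0 -> `|y - x| <= d -> u y - u x <=
    (p + a * x) * (y - x) + a / 2 * (y - x) ^+ 2 + C * x ^+ 2.
  rewrite ler_norml => y0 /andP[yx1 yx2].
  have y1 : -1 - d <= y < 1 by apply/andP; split; lra.
  have y2 : -1 - d <= y <= 0 by apply/andP; split; lra.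
  have yd : `|y - 0| <= d by rewrite subr0 ltr0_norm//; lra.
  have := tP _ y1 yd; have := hleu _ y2; rewrite subr0 => h1 h2.
  have : 0 <= (P - p) * (- y) by rewrite mulr_ge0; lra.
  have : 0 <= - a / 2 * x ^+ 2 by rewrite mulr_ge0 ?sqr_ge0//; lra.
  move: gx; rewrite ler_norml => /andP[gx _]; rewrite ux.
  by lra.
have := left_integral_le hk x0 iI bound.
have W0 := weight_ge0 hk (ltW x0).
have W1 := far_moment2_ge hk x0; have W2 := far_moment1_le hk x0.
have W3 := far_moment0_le hk x0; have W4 := far_moment_ge0 hk 1 x0.
have := Wr _ x0 xr; rewrite -[leRHS]mul1r ler_pdivlMr; last by rewrite -invr_gt0.
have FM : - M2 <= F x by have := FM2 x1; rewrite ler_norml => /andP[].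
move: E; set W := weight k x in W0 W1 W2 W3 *; set mu2 := far_moment k 2 x in W1 *.
set mu1 := far_moment k 1 x in W2 W4 *; set mu0 := far_moment k 0 x in W3 *.
rewrite ler0_norm; last by lra.
move=> E WW I.
have : W * g2 x <= W * C by rewrite ler_wpM2l// (le_trans (ler_norm _)).
have : mu1 * g1 x <= mu1 * (p + C * x).
  by rewrite ler_wpM2l// -lerBlDl (le_trans (ler_norm _)).
have : C * (x * mu1) <= C * W by rewrite ler_wpM2l.
have : C * (x ^+ 2 * mu0) <= C * W by rewrite ler_wpM2l.
have : (- a) * (x * mu1) <= (- a) * W by rewrite ler_wpM2l//; lra.
have : 0 <= (- a) * (mu2 - (1 - W)) by apply: mulr_ge0; lra.
have : 0 <= (- a) * W by apply: mulr_ge0; lra.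
by lra.
Qed.

(* the two endpoints are reached by continuity *)
Let u_outer (x : R) : -1 - d <= x <= -1 -> u x = 0.
Proof.
have dp := d0; move=> /andP[x1 x2].
have dl : -1 - d < 0 by lra.
have [cu cuL _] := (continuous_within_itvP u dl).1 (qnl_left hu).
have [->|xL] := eqVneq x (-1 - d).
  apply/eqP; apply: contrapT => /negP u0.
  have un : 0 < `|u (-1 - d)| by rewrite normr_gt0.
  near (-1 - d)^'+ => t.
  have ut : u t = 0.
    apply: (qnl_outer hu); apply/andP; split; near: t; first exact: nbhs_right_gt.
    by apply: nbhs_right_lt; lra.
  have : `|u (-1 - d) - u t| < `|u (-1 - d)|.
    by near: t; exact: (cvgr_dist_lt _ _ cuL).
  by rewrite ut subr0 ltxx.
have [->|xR] := eqVneq x (-1).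
  apply/eqP; apply: contrapT => /negP u0.
  have un : 0 < `|u (-1)| by rewrite normr_gt0.
  have /cvg_at_left_filter cuR : u y @[y --> (-1 : R)] --> u (-1).
    by apply: cu; rewrite in_itv/=; apply/andP; split; lra.
  near (-1 : R)^'- => t.
  have ut : u t = 0.
    apply: (qnl_outer hu); apply/andP; split; near: t; last exact: nbhs_left_lt.
    by apply: nbhs_left_gt; lra.
  have : `|u (-1) - u t| < `|u (-1)|.
    by near: t; exact: (cvgr_dist_lt _ _ cuR).
  by rewrite ut subr0 ltxx.
by apply: (qnl_outer hu); rewrite !lt_neqAle x1 x2 xR eq_sym xL.
Unshelve. all: by end_near. Qed.

Let Phi_continuous (a b : R) : -1 - d <= a -> b <= 1 ->
  {within `[a, b], continuous Phi}.
Proof.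
move=> ha hb x; apply: continuousD.
  apply: (continuous_subspaceW _ cU) => y /=; rewrite !in_itv/= => /andP[ay yb].
  by rewrite (le_trans ha ay) (le_trans yb hb).
have : continuous barrier.
  have -> : barrier = ((K * d) \*o (cst 4 \- (fun y => y ^+ 2))) \+
      (N \*o (cst (4 * d) \- (2^-1 \*o huber d))).
    by apply/funext => y; rewrite /barrier/= [2^-1 * _]mulrC.
  move=> y; have ch : {for y, continuous (huber d)} by exact: huber_continuous.
  apply: continuousD.
    apply: (@continuousM _ _ (cst (K * d))); first exact: cst_continuous.
    by apply: continuousB; [exact: cst_continuous|exact: exprn_continuous].
  apply: (@continuousM _ _ (cst N)); first exact: cst_continuous.
  apply: continuousB; first exact: cst_continuous.
  by apply: (@continuousM _ _ (cst 2^-1)) => //; exact: cst_continuous.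
by move/(@continuous_subspaceT _ _ `[a, b]); exact.
Qed.

Theorem qnl_upper_bound (x : R) : -1 < x < 1 -> u x <= U x + 4 * (K + N) * d.
Proof.
have dp := d0; have d1' := d1; move=> /andP[x1 x2].
apply: (@le_trans _ _ (Phi x)); last by rewrite /Phi lerD2l barrier_le.
have cw1 : {within `[-1 - d, 0], continuous (fun y => u y - Phi y)}.
  move=> y; apply: continuousB; first exact: (qnl_left hu).
  by apply: Phi_continuous.
have cw2 : {within `[0, 1], continuous (fun y => g y - Phi y)}.
  move=> y; apply: continuousB; first exact: (qnl_right hu).
  by apply: Phi_continuous => //; lra.
have dl : -1 - d <= 0 by lra.
have [c1 /[!in_itv]/= /andP[c1l c1r] max1] := EVT_max dl cw1.
have [c2 /[!in_itv]/= /andP[c2l c2r] max2] := EVT_max ler01 cw2.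
have Phi0 y : -1 - d <= y <= -1 \/ y = 1 -> 0 <= Phi y.
  move=> yy; have U0 : U y = 0 by case: yy => [/Uout|->].
  rewrite /Phi U0 add0r; apply: barrier_ge0.
  by case: yy => [/andP[? ?]|->]; apply/andP; split; lra.
have glue1 : g 1 = 0 by rewrite -(qnl_glue hu) ?(qnl_end hu)// ltr01 lexx.
rewrite leNgt; apply/negP => ux.
have [m21|m12] := lerP (g c2 - Phi c2) (u c1 - Phi c1).
- have le1 y : -1 - d <= y < 1 -> u y <= Phi y + (u c1 - Phi c1).
    move=> /andP[y1 y2]; have [y0|y0] := lerP y 0.
      by have := max1 y; rewrite in_itv/= y1 y0 => /(_ isT); lra.
    have y01 : 0 < y <= 1 by rewrite y0 ltW.
    rewrite (qnl_glue hu y01).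
    by have := max2 y; rewrite in_itv/= (ltW y0) (ltW y2) => /(_ isT); lra.
  have [c11|c11] := lerP c1 (-1).
    have u0 : u c1 = 0 by apply: u_outer; rewrite c1l.
    have P0 : 0 <= Phi c1 by apply: Phi0; left; rewrite c1l.
    by have := le1 x; rewrite x2 andbT (_ : -1 - d <= x); [move=> /(_ isT)|]; lra.
  apply: (@no_touching_nonlocal c1 (u c1 - Phi c1)) => //; last lra.
  by rewrite c11.
- have le1 y : -1 - d <= y <= 0 -> u y <= Phi y + (g c2 - Phi c2).
    by move=> y1; have := max1 y; rewrite in_itv/= y1 => /(_ isT); lra.
  have le2 y : 0 < y < 1 -> g y <= Phi y + (g c2 - Phi c2).
    by move=> /andP[y1 y2]; have := max2 y; rewrite in_itv/= (ltW y1) (ltW y2) => /(_ isT); lra.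
  have mpos : 0 < g c2 - Phi c2.
    have [x0|x0] := lerP x 0.
      by have := le1 x; rewrite x0 andbT (_ : -1 - d <= x); [move=> /(_ isT)|]; lra.
    by have := le2 x; rewrite -(qnl_glue hu) x0 ?x2 ?(ltW x2)// => /(_ isT); lra.
  have [c20|c20] := eqVneq c2 0.
    by apply: (@no_touching_interface (g c2 - Phi c2)) => //; rewrite c20; lra.
  have [c21|c21] := eqVneq c2 1.
    by have := Phi0 c2 (or_intror c21); move: mpos; rewrite c21 glue1; lra.
  apply: (@no_touching_right c2 (g c2 - Phi c2)) => //; last lra.
  by rewrite !lt_neqAle c2l c2r c21 eq_sym c20.
Qed.

End comparison.

(** * The local solution and conclusion *)

Lemma Linfty_Omega_le {R : realType} (v : R -> R) (C : R) : 0 <= C ->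
  (forall x : R, -1 < x < 1 -> `|v x| <= C) -> (Linfty_Omega v <= C%:E)%E.
Proof.
move=> C0 vC; rewrite /Linfty_Omega unlock.
case: ifPn => // _; apply/ess_supP; apply: aeW => x /=.
rewrite lee_fin patchE; case: ifPn => [|_]; last by rewrite normr0.
by rewrite inE/= in_itv/=; exact: vC.
Qed.

Lemma Ck_closed3_data {R : realType} (a b : R) (U : R -> R) : a < b ->
  Ck_closed 3 a b U -> exists M2 M3 : R,
  [/\ 0 <= M3, forall x : R, a < x < b -> `|derive1n 2 U x| <= M2 &
  forall x y : R, a < x < b -> a < y < b ->
  `|U y - (U x + derive1 U x * (y - x) + derive1n 2 U x / 2 * (y - x) ^+ 2)| <=
  M3 * `|y - x| ^+ 3].
Proof.
move=> ab [cU dU hU].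
have B i : (i <= 3)%N -> exists M : R, forall x : R, a < x < b -> `|derive1n i U x| <= M.
  move=> /hU[h [ch eh]]; have [M HM] := bounded_on_segment (ltW ab) ch.
  exists M => x /[dup] xab /andP[ax xb]; rewrite eh//.
  by apply: HM; rewrite !ltW.
have [M2 HM2] := B 2%N isT; have [M3 HM3] := B 3%N isT.
have D i : (i < 3)%N -> forall x : R, a < x < b ->
    is_derive x 1 (derive1n i U) (derive1n i.+1 U x).
  by move=> i3 x xab; rewrite derive1nS derive1E; apply/derivableP; exact: dU.
exists M2, M3; split => //.
  have mab : a < (a + b) / 2 < b by apply/andP; split; lra.
  exact: le_trans (HM3 _ mab).
by apply: (taylor2_bound (D 0%N isT) (D 1%N isT) (D 2%N isT)).
Qed.

Lemma local_solution_extension {R : realType} (f u0 : R -> R) (x : R) :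
  local_strong_solution f u0 -> -1 < x < 1 ->
  derive1n 2 (patch (cst 0) `[-1, 1] u0) x = - f x.
Proof.
move=> [h _ _] x11; have [du ddu fx] := h x x11; rewrite -fx opprK.
pose U := patch (cst 0) `[-1, 1] u0.
have near_in (y : R) : -1 < y < 1 -> \forall z \near y, u0 z = U z.
  move=> /andP[y1 y2]; near=> z; rewrite /U patchE ifT//.
  rewrite inE/= in_itv/=; apply/andP; split; apply: ltW; near: z.
    exact: lt_nbhsr.
  exact: lt_nbhsl.
have D1 (y : R) : -1 < y < 1 -> is_derive y 1 U (derive1 u0 y).
  move=> y1; apply: near_eq_is_derive (near_in y y1) _.
  by rewrite derive1E; apply/derivableP; have [] := h y y1.
have D2 : is_derive x 1 (derive1 U) (derive1n 2 u0 x).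
  have : is_derive x 1 (derive1 u0) (derive1n 2 u0 x).
    by rewrite derive1nS derive1E; apply/derivableP.
  have /andP[xl xr] := x11; apply: near_eq_is_derive; near=> y.
  have y1 : -1 < y < 1.
    by apply/andP; split; [near: y; exact: lt_nbhsr|near: y; exact: lt_nbhsl].
  by rewrite [RHS]derive1E (@derive_val _ _ _ _ _ _ _ (D1 _ y1)).
by rewrite derive1nS derive1E (@derive_val _ _ _ _ _ _ _ D2).
Unshelve. all: by end_near. Qed.

Theorem theorem4p1 (R : realType) (gamma f u0 : R -> R) (u : R -> R -> R)
    (d1 : R)
    (hgamma : admissible_kernel gamma)
    (hd1 : 0 < d1 <= 1)
    (hu0 : local_strong_solution f u0)
    (hu : forall d : R, 0 < d < d1 -> qnl_strong_solution gamma d f (u d))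
    (hreg : forall d : R, 0 < d < d1 ->
       Ck_closed 3 (-1 - d) 1 (patch (cst 0) `[-1, 1] u0)) :
  exists C d0 : R, [/\ 0 < C, 0 < d0 &
    forall d : R, 0 < d < d0 ->
      (Linfty_Omega (fun x => u d x - u0 x)%R <= (C * d)%:E)%E].
Proof.
have /andP[d10 d11] := hd1; set U := patch (cst 0) `[-1, 1] u0 in hreg.
pose D := d1 / 2; have D0 : 0 < D by rewrite divr_gt0.
have D1 : D < d1 by rewrite /D; lra.
have regD : Ck_closed 3 (-1 - D) 1 U by apply: hreg; rewrite D0.
have cD : {within `[-1 - D, 1], continuous U} by case: regD.
have ab : -1 - D < 1 by lra.
have [M2 [M3 [M30 FM2 tay]]] := Ck_closed3_data ab regD.
have F2 (x : R) : -1 < x < 1 -> derive1n 2 U x = - f x.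
  exact: local_solution_extension.
have M20 : 0 <= M2 by apply: le_trans (normr_ge0 _) (FM2 0 _); apply/andP; split; lra.
have [_ u0L u0R] := hu0.
have UE (x : R) : -1 <= x <= 1 -> U x = u0 x.
  by move=> x1; rewrite /U patchE ifT// inE/= in_itv.
exists (4 * ((M3 + 1) + (3 * M2 + 3))), D; split => //; first lra.
move=> d /andP[d0 dD].
have dd1 : 0 < d < d1 by rewrite d0; lra.
have d01 : 0 < d < 1 by rewrite d0; lra.
have hk := scaled_kernelP hgamma d0.
have [g [g1 [g2 [p [C hq]]]]] := qnl_strong_solution_data hgamma d01 (hu _ dd1).
have cU : {within `[-1 - d, 1], continuous U}.
  apply: (continuous_subspaceW _ cD) => x /=; rewrite !in_itv/= => /andP[xl ->].
  by rewrite andbT; lra.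
have bF (x : R) : -1 < x < 1 -> `|- f x| <= M2.
  by move=> x1; rewrite -F2//; apply: FM2; case/andP: x1 => ? ?; apply/andP; split; lra.
have Uout (y : R) : -1 - d <= y <= -1 -> U y = 0.
  move=> /andP[_ y1]; have [->|yn] := eqVneq y (-1); first by rewrite UE// lexx/=; lra.
  rewrite /U patchE ifF//; apply/negbTE; rewrite notin_setE/= in_itv/=.
  by apply/negP; rewrite negb_and -!ltNge lt_neqAle yn y1.
have U1 : U 1 = 0 by rewrite UE// lexx andbT; lra.
have tU (x y : R) : -1 < x < 1 -> -1 - d <= y < 1 ->
  `|U y - (U x + derive1 U x * (y - x) + - f x / 2 * (y - x) ^+ 2)| <= M3 * `|y - x| ^+ 3.
  move=> x1 /andP[y1 y2]; rewrite -(F2 _ x1); apply: tay.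
    by case/andP: x1 => ? ?; apply/andP; split; lra.
  by apply/andP; split; lra.
apply: Linfty_Omega_le; first by rewrite !mulr_ge0 ?(ltW d0)//; lra.
move=> x x1; rewrite -(UE x); last by case/andP: x1 => /ltW -> /ltW ->.
rewrite ler_distl; apply/andP; split; last first.
  apply: (qnl_upper_bound (U1 := derive1 U) hk d01 hq) => //.
  by move=> t y t1 y1; have := tU t y t1 y1; rewrite ler_norml => /andP[_]; lra.
have := qnl_upper_bound (U := fun y => - U y) (U1 := fun y => - derive1 U y)
  (M2 := M2) (M3 := M3) hk d01 (qnl_dataN hq) _ _ _ _ _ _ x1.
have cNU : {within `[-1 - d, 1], continuous (fun y => - U y)}.
  by move=> y; apply: continuousN; exact: cU.
have tNU (t y : R) : -1 < t < 1 -> -1 - d <= y < 1 ->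
    - U y <= - U t + - derive1 U t * (y - t) + - - f t / 2 * (y - t) ^+ 2 + M3 * `|y - t| ^+ 3.
  by move=> t1 y1; have := tU t y t1 y1; rewrite ler_norml => /andP[+ _]; lra.
move=> /(_ cNU tNU); rewrite U1 oppr0.
have bNF (t : R) : -1 < t < 1 -> `|- - f t| <= M2 by move=> t1; rewrite normrN bF.
have NUout (y : R) : -1 - d <= y <= -1 -> - U y = 0 by move=> /Uout ->; rewrite oppr0.
by move=> /(_ bNF NUout erefl M30); lra.
Qed.
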